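(* There exists a compact set $Y \subseteq \partial\, \overline{\mathbb{D}}^{\,2}$ in $\mathbb{C}^2$ such that $(0,0) \in \widehat{Y}$, and yet $P(Y)$ has dense invertibles. In particular, setting $X = \widehat{Y}$, the uniform algebra $A := P(X)$ is natural on $X$ and $A$ has dense invertibles, but the Shilov boundary $\Gamma_A$ is a proper subset of $X$.
   Context: $\mathbb{D}$ is the open unit disk in $\mathbb{C}$, $\overline{\mathbb{D}}^{\,2} = \{(z,w)\in\mathbb{C}^2 : |z|\le 1,\ |w|\le 1\}$ is the closed bidisk, and $\partial\,\overline{\mathbb{D}}^{\,2}$ is its topological boundary in $\mathbb{C}^2$. For a non-empty compact set $K$ and a function $f$, $|f|_K = \sup_{x\in K}|f(x)|$ is the uniform norm. For a non-empty compact set $K \subseteq \mathbb{C}^n$, $\widehat{K} = \{\underline{z} \in \mathbb{C}^n : |p(\underline{z})| \le |p|_K \text{ for every polynomial } p\}$ is the polynomially convex hull of $K$, where the polynomials are those in $n$ complex variables with complex coefficients. $P(K)$ is the uniform closure in $C(K)$ (the algebra of continuous complex-valued functions on $K$) of the set of restrictions to $K$ of these polynomials. A uniform algebra on a non-empty compact Hausdorff space $X$ is a uniformly closed, unital subalgebra of $C(X)$ that separates the points of $X$; it is a Banach algebra with respect to the norm $|f|_X$. Its maximal ideal space (character space, with the Gelfand topology) is denoted by $\Phi_A$. $A$ is natural on $X$ if $\Phi_A = X$, i.e. every character of $A$ is evaluation at a point of $X$. The Shilov boundary $\Gamma_A$ is the minimum non-empty closed subset $K$ of $X$ such that $|f|_K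 = |f|_X$ for all $f \in A$. A unital Banach algebra has dense invertibles if its group of invertible elements is (norm) dense in it. *)

(* Defs.v *)
From HB Require Import structures.
From mathcomp Require Import all_boot all_order all_algebra.
From mathcomp Require Import all_classical all_reals all_analysis.
From mathcomp Require Import complex.
(* Not imported: the notations of mpoly clash with those of all_analysis. *)
From mathcomp Require mpoly.

Set Implicit Arguments.
Unset Strict Implicit.
Unset Printing Implicit Defensive.

Import Order.TTheory GRing.Theory Num.Theory.
Import numFieldNormedType.Exports.

Local Open Scope classical_set_scope.
Local Open Scope ring_scope.

(* The library topologizes an abstract numFieldType and the alias R[i]^o, but
   not the type R[i] itself. *)
HB.instance Definition _ (R : rcfType) := PseudoPointedMetric.copy R[i] R[i]^o.
HB.instance Definition _ (R : rcfType) := NormedModule.copy R[i] R[i]^o.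

Section SupNorm.
Variables (R : realType) (T : Type).

(* The values are real, unlike those of `|f x| : R[i]. *)
Definition unorm (K : set T) (f : T -> R[i]) : R :=
  sup [set Normc.normc (f x) | x in K].

End SupNorm.

Section UniformAlgebras.
Variables (R : realType) (X : topologicalType).
Implicit Types (A B : set (X -> R[i])) (K G : set X).

Definition contfun : set (X -> R[i]) := [set f | continuous f].

(* The closure in C(X), seen as a subspace of all the functions on X with the
   topology of uniform convergence. *)
Definition uniform_closure B : set (X -> R[i]) :=
  contfun `&` closure (B : set {uniform X -> R[i]}).

Definition uniform_algebra A : Prop :=
  [/\ [/\ [set: X] !=set0, compact [set: X] & hausdorff_space X],
      A `<=` contfun,
      [/\ A 1,
          forall (c : R[i]) f g, A f -> A g -> A (c *: f + g)
        & forall f g, A f -> A g -> A (f * g)],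
      uniform_closure A `<=` A
    & forall x y, x <> y -> exists2 f, A f & f x <> f y].

Definition invertibles A : set (X -> R[i]) :=
  [set f | A f /\ exists2 g, A g & f * g = 1].

Definition dense_invertibles A : Prop :=
  A `<=` uniform_closure (invertibles A).

(* Only the values of phi on A are relevant. *)
Definition character A (phi : (X -> R[i]) -> R[i]) : Prop :=
  [/\ forall (c : R[i]) f g, A f -> A g ->
        phi (c *: f + g) = c * phi f + phi g,
      forall f g, A f -> A g -> phi (f * g) = phi f * phi g
    & exists2 f, A f & phi f <> 0].

Definition natural_on A : Prop :=
  forall phi, character A phi -> exists x, forall f, A f -> phi f = f x.

Definition closed_boundary A K : Prop :=
  [/\ K !=set0, closed K & forall f, A f -> unorm K f = unorm [set: X] f].

Definition is_shilov_boundary A G : Prop :=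
  closed_boundary A G /\ forall K, closed_boundary A K -> G `<=` K.

End UniformAlgebras.

Section PolynomialConvexity.
Variables (R : realType) (n : nat).
Implicit Types K : set 'rV[R[i]]_n.

Definition peval (p : mpoly.mpoly n R[i]) (z : 'rV[R[i]]_n) : R[i] :=
  mpoly.meval (z ord0) p.

Definition poly_hull K : set 'rV[R[i]]_n :=
  [set z | forall p, Normc.normc (peval p z) <= unorm K (peval p)].

(* P(K), whose elements are functions on the subspace K. *)
Definition Palg K : set (set_type K -> R[i]) :=
  uniform_closure (range (fun p (z : set_type K) => peval p (set_val z))).

End PolynomialConvexity.

Arguments Palg {R n} K _.

Definition top_boundary (T : topologicalType) (A : set T) : set T :=
  closure A `\` interior A.

Definition closed_bidisk (R : realType) : set 'rV[R[i]]_2 :=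
  [set z | forall i, Normc.normc (z ord0 i) <= 1].
Arguments closed_bidisk : clear implicits.

(* Main.v *)
Require Import Defs.
From mathcomp Require Import all_boot all_order all_algebra.
From mathcomp Require Import all_classical all_reals all_analysis.
From mathcomp Require Import complex ring lra.
From mathcomp Require mpoly.
(* The notations of mpoly clash with those of all_analysis, but its canonical
   ring structures are needed. *)
Import (canonicals, coercions) mpoly.

(**
Choose polynomials f_0, f_1, ... with f_n(0) <> 0 which are dense, uniformly on
the closed bidisk, and define G_0 = 1 and
  G_(n+1) = f_n * ((M + G_n) / (M + 1)) ^ N / f_n(0)
with M and then N large. On the bidisk, the N-th power is small wherever
Re G_n < 1/2, so Re G_(n+1) >= 1/2 implies Re G_n >= 1/2, and G_(n+1)(0) = 1.
Let Y be the set of the boundary points z of the bidisk such that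
Re G_n(z) >= 1/2 for all n. For large r, |1 - G_(n+1) / r| is bounded by some
s < 1 on Y, hence on its hull, so that G_(n+1), and with it f_n, is invertible
in P(Y) and in P(X).

The origin lies in the hull of each {z in the boundary | Re G_n(z) >= 1/2},
hence in the hull of their decreasing intersection Y. This is an effect of two
dimensions, of the same nature as Hartogs' extension theorem; see
[polyfun_hull].
*)

Set Implicit Arguments.
Unset Strict Implicit.
Unset Printing Implicit Defensive.
Import Order.TTheory GRing.Theory Num.Theory.
Import numFieldNormedType.Exports.
Local Open Scope classical_set_scope.
Local Open Scope ring_scope.

(** Two variables enter as follows. If |b| = 1, the whole disk of the points (a, b) with |a| <= 1
    lies in the boundary of the bidisk, so a hypothesis about boundary points gives control inside
    the circle over which a mean in a is taken; likewise with a and b exchanged. In one variable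
    only the circle itself would be available. The hull estimate compares p with (1 - F) u, which
    vanishes at the origin. The choice u = p / (1 - F) is spoiled by poles; they are cut off, at the
    price of holomorphy, and the defect lives where Re F >= 1/2, that is, where |p| <= eta. This
    bounds |p(0)| by a multiple of eta only, and powers of p remove the factor. What is needed is
    thus a mean value property with an error linear in the defect. Means over the powers of a root
    of unity w close to 1 replace integrals, and expansions with a first-order error term replace
    derivatives, so that a Lipschitz cut-off is smooth enough. *)

Local Notation cnorm := Normc.normc.

(** * The modulus of complex numbers *)

Section ComplexModulus.
Variable R : rcfType.
Implicit Types x y z : R[i].

Lemma normcE x : `|x| = (cnorm x)%:C%C.
Proof. by case: x. Qed.

Lemma cnorm_ge0 x : 0 <= cnorm x.
Proof. by case: x => a b; apply: sqrtr_ge0. Qed.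

Lemma cnorm0 : cnorm (0 : R[i]) = 0. Proof. exact: Normc.normc0. Qed.
Lemma cnorm1 : cnorm (1 : R[i]) = 1. Proof. exact: Normc.normc1. Qed.

Lemma cnormN x : cnorm (- x) = cnorm x. Proof. exact: normcN. Qed.

Lemma cnormM x y : cnorm (x * y) = cnorm x * cnorm y.
Proof. exact: Normc.normcM. Qed.

Lemma cnormX x n : cnorm (x ^+ n) = cnorm x ^+ n.
Proof. by elim: n => [|n IH]; rewrite ?expr0 ?cnorm1 // !exprS cnormM IH. Qed.

Lemma cnormD_le x y a b : cnorm x <= a -> cnorm y <= b -> cnorm (x + y) <= a + b.
Proof. by move=> xa yb; apply: le_trans (le_normcD _ _) (lerD xa yb). Qed.

Lemma cnormB_le x y a b : cnorm x <= a -> cnorm y <= b -> cnorm (x - y) <= a + b.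
Proof. by move=> xa yb; apply: cnormD_le; rewrite ?cnormN. Qed.

Lemma cnormM_le x y a b : cnorm x <= a -> cnorm y <= b -> cnorm (x * y) <= a * b.
Proof. by move=> xa yb; rewrite cnormM ler_pM ?cnorm_ge0. Qed.

Lemma cnormC (r : R) : cnorm r%:C%C = `|r|.
Proof. by rewrite /= expr0n addr0 sqrtr_sqr. Qed.

Lemma cnorm_eq0 x : (cnorm x == 0) = (x == 0).
Proof.
by apply/eqP/eqP => [/Normc.eq0_normc //|->]; rewrite cnorm0.
Qed.

Lemma sqr_cnorm x : cnorm x ^+ 2 = complex.Re x ^+ 2 + complex.Im x ^+ 2.
Proof. by case: x => a b /=; rewrite sqr_sqrtr // addr_ge0 ?sqr_ge0. Qed.

Lemma Re_le_cnorm x : `|complex.Re x| <= cnorm x.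
Proof.
rewrite -(@ler_pXn2r _ 2) ?nnegrE ?cnorm_ge0 // sqr_cnorm real_normK ?num_real //.
by rewrite lerDl sqr_ge0.
Qed.

Lemma cnorm_sum (I : Type) (r : seq I) (F : I -> R[i]) (a : I -> R) :
  (forall i, cnorm (F i) <= a i) ->
  cnorm (\sum_(i <- r) F i) <= \sum_(i <- r) a i.
Proof.
move=> Fa; elim: r => [|i r IH]; first by rewrite !big_nil cnorm0.
by rewrite !big_cons; apply: cnormD_le.
Qed.

Lemma cnorm_mean (n : nat) (F : 'I_n.+1 -> R[i]) (a : R) :
  (forall i, cnorm (F i) <= a) ->
  cnorm ((\sum_i F i) / n.+1%:R) <= a.
Proof.
move=> Fa; rewrite cnormM Normc.normcV.
have -> : cnorm (n.+1%:R : R[i]) = n.+1%:R.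
  by rewrite -(rmorph_nat (real_complex R)) cnormC ger0_norm.
rewrite ler_pdivrMr ?ltr0n //; apply: le_trans (cnorm_sum _ Fa) _.
by rewrite sumr_const card_ord mulr_natr.
Qed.

End ComplexModulus.

Lemma geometric_small (R : archiRealFieldType) (x C e : R) :
  0 <= x < 1 -> 0 < e -> exists n, C * x ^+ n < e.
Proof.
move=> /andP[x0 x1] e0.
have [->|xn0] := eqVneq x 0; first by exists 1%N; rewrite expr1 mulr0.
have xp : 0 < x by rewrite lt_neqAle eq_sym xn0.
pose d := x^-1 - 1.
have dp : 0 < d by rewrite subr_gt0 invf_gt1.
have bern n : 1 + n%:R * d <= x^-1 ^+ n.
  elim: n => [|n IH]; first by rewrite mul0r addr0 expr0.
  rewrite exprSr; have -> : x^-1 = 1 + d by rewrite /d; lra.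
  have := ler_pM _ _ IH (lexx (1 + d)).
  have nd : 0 <= n%:R * d by rewrite mulr_ge0 // ltW.
  move=> /(_ ltac:(lra) ltac:(lra)); have -> : x^-1 = 1 + d by rewrite /d; lra.
  apply: le_trans; rewrite -natr1.
  have : 0 <= n%:R * d * d by rewrite mulr_ge0 // ltW.
  lra.
pose n := Num.bound (`|C| / e / d).
have Hn : `|C| / e / d < n%:R by apply: archi_boundP; rewrite !mulr_ge0 ?invr_ge0 // ltW.
exists n; apply: le_lt_trans (ler_wpM2r (exprn_ge0 _ x0) (ler_norm C)) _.
have := bern n; rewrite exprVn => bn.
rewrite -ltr_pdivlMr ?exprn_gt0 //; rewrite -ltr_pdivrMl //.
rewrite mulrC; apply: lt_le_trans bn; rewrite ltr_pdivrMr // in Hn.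
lra.
Qed.

(** A factor independent of k disappears on taking k-th roots: if y < x, then C (y / x)^k < 1 for
    some k. *)
Lemma exp_domination (R : archiRealFieldType) (x y C : R) :
  0 <= x -> 0 <= y -> (forall k, x ^+ k <= C * y ^+ k) -> x <= y.
Proof.
move=> x0 y0 H; case: (leP x y) => // yx.
have xp : 0 < x by apply: le_lt_trans yx.
have [|n Hn] := @geometric_small _ (y / x) C 1 _ ltr01.
  by rewrite divr_ge0 //= ltr_pdivrMr // mul1r.
move: Hn; rewrite exprMn exprVn mulrA ltr_pdivrMr ?exprn_gt0 // mul1r.
by move/lt_le_trans => /(_ _ (H n)); rewrite ltxx.
Qed.

(** * Means over roots of unity *)

Section Means.
Variable R : realType.
Local Notation C := R[i].
Implicit Types a t w z : C.

(** Repeated square roots of -1, always taken with Re v >= 0: then |v + 1|^2 = 2 + 2 Re v >= 2, and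
    w - 1 = (v - 1)(v + 1) shows that the squared distance to 1 is at least halved each time. *)
Lemma root_of_unity_near1 (e : R) : 0 < e ->
  exists N w, [/\ w ^+ N.+1 = 1, w != 1, cnorm w = 1 & cnorm (w - 1) < e].
Proof.
move=> e0.
have H q : exists N w, [/\ w ^+ N.+1 = 1, w != 1, cnorm w = 1 &
    cnorm (w - 1) ^+ 2 <= 4%:R * 2^-1 ^+ q].
  elim: q => [|q [N [w [wN w1 nw dw]]]].
    exists 1%N, (-1); split; first by rewrite sqrrN expr1n.
    - by rewrite -subr_eq0 -opprD oppr_eq0 -(natrD _ 1 1) pnatr_eq0.
    - by rewrite cnormN cnorm1.
    rewrite -opprD cnormN expr0 mulr1.
    have : cnorm (1 + 1 : C) <= 1 + 1 by apply: cnormD_le; rewrite cnorm1.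
    have := cnorm_ge0 (1 + 1 : C); nra.
  have [v v2 Rv] : exists2 v : C, v ^+ 2 = w & 0 <= complex.Re v.
    case: (leP 0 (complex.Re (sqrtc w))) => h.
      by exists (sqrtc w) => //; rewrite sqr_sqrtc.
    exists (- sqrtc w); first by rewrite sqrrN sqr_sqrtc.
    by rewrite raddfN /= oppr_ge0 ltW.
  have nv : cnorm v = 1.
    apply/eqP; rewrite -(@eqrXn2 _ 2) ?cnorm_ge0 //.
    by rewrite -cnormX v2 nw expr1n.
  exists (N.+1 * 2).-1, v; split => //.
  - by rewrite prednK ?muln_gt0 // mulnC exprM v2.
  - by apply: contra_neq w1 => v1; rewrite -v2 v1 expr1n.
  have E : w - 1 = (v - 1) * (v + 1) by rewrite -v2; ring.
  move: dw; rewrite E cnormM exprMn.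
  have : 2 <= cnorm (v + 1) ^+ 2.
    have vv := sqr_cnorm v; rewrite nv expr1n in vv.
    by rewrite sqr_cnorm !raddfD /= addr0 sqrrD; lra.
  have := sqr_ge0 (cnorm (v - 1)) => h1 h2 h3.
  have := ler_wpM2l h1 h2; rewrite [_ ^+ q.+1]exprS; lra.
have [|q Hq] := @geometric_small R (2^-1) 4%:R (e ^+ 2) _ (exprn_gt0 2 e0).
  by rewrite invr_ge0 invf_lt1 ?ltr1n // ler0n.
have [N [w [wN w1 nw dw]]] := H q; exists N, w; split => //.
rewrite -(@ltr_pXn2r _ 2) ?nnegrE ?cnorm_ge0 ?(ltW e0) //.
exact: le_lt_trans dw Hq.
Qed.

(** A discrete circle mean. It is used when [w ^+ N.+1 = 1], with |w - 1| as mesh; [w] need not be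
    primitive, as only invariance under rotation by [w] matters. *)
Definition rmean N w (f : C -> C) : C := (\sum_(j < N.+1) f (w ^+ j)) / N.+1%:R.

Lemma sum_rotate N w (f : C -> C) (r : C) : w ^+ N.+1 = 1 ->
  \sum_(j < N.+1) f (r * w ^+ j.+1) = \sum_(j < N.+1) f (r * w ^+ j).
Proof.
move=> wN; rewrite big_ord_recr /= wN [RHS]big_ord_recl expr0 addrC.
by congr (_ + _).
Qed.

(* A function which is complex differentiable up to an error A |t| has small
   mean on the unit circle if it vanishes at 0: passing from the circle of
   radius r to that of radius r + h changes the mean by at most about 2 A h,
   since the tangential differences cancel in the mean over a full turn. *)
Lemma mean_almost_holomorphic (phi : C -> C) (A B t0 : R) N w :
  0 <= A -> 0 <= B -> 0 < t0 -> phi 0 = 0 ->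
  (forall a, cnorm a <= 1 -> exists2 L : C, cnorm L <= B &
     forall t, cnorm t <= t0 -> cnorm (a + t) <= 1 ->
       cnorm (phi (a + t) - phi a - t * L) <= A * cnorm t + B * cnorm t ^+ 2) ->
  w ^+ N.+1 = 1 -> w != 1 -> cnorm w = 1 -> cnorm (w - 1) <= t0 ->
  cnorm (rmean N w phi) <= 2 * A + B * cnorm (w - 1).
Proof.
move=> A0 B0 t00 phi0 Hphi wN w1 nw wt; set s := cnorm (w - 1).
have s0 : 0 < s by rewrite lt_neqAle cnorm_ge0 eq_sym cnorm_eq0 subr_eq0 w1.
have nwj j : cnorm (w ^+ j) = 1 by rewrite cnormX nw expr1n.
pose M (r : R) := rmean N w (fun a => phi (r%:C%C * a)).
have nrw (r : R) j : 0 <= r -> cnorm (r%:C%C * w ^+ j) = r.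
  by move=> r0; rewrite cnormM nwj mulr1 cnormC ger0_norm.
have step (r h : R) : 0 < r -> 0 < h -> h <= t0 -> r + h <= 1 ->
    cnorm (M (r + h) - M r) <= h * (2 * A + B * (h + s)).
  move=> r0 h0 ht rh1.
  (* [c] turns the tangential increment [(w - 1) * a] into the radial increment [t1], so that the
     linear terms in [L] cancel; subtracting the tangential differences is free, since they sum to
     0. *)
  pose c : C := (h / r)%:C%C / (w - 1).
  have nc : cnorm c * (s * r) = h.
    rewrite /c cnormM Normc.normcV cnormC ger0_norm ?divr_ge0 ?ltW // -/s.
    by field; rewrite !gt_eqF.
  have -> : M (r + h) - M r = rmean N w (fun a =>
      (phi (r%:C%C * a + h%:C%C * a) - phi (r%:C%C * a)) -
      c * (phi (r%:C%C * a + (w - 1) * (r%:C%C * a)) - phi (r%:C%C * a))).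
    rewrite /M /rmean !sumrB -mulr_sumr sumrB.
    have -> : \sum_(j < N.+1) phi (r%:C%C * w ^+ j + (w - 1) * (r%:C%C * w ^+ j))
            = \sum_(j < N.+1) phi (r%:C%C * w ^+ j).
      rewrite -(sum_rotate _ _ wN); apply: eq_bigr => j _.
      by congr phi; rewrite exprS; ring.
    rewrite subrr mulr0 subr0 mulrBl; congr (_ / _ - _).
    by apply: eq_bigr => j _; rewrite rmorphD mulrDl.
  apply: cnorm_mean => j.
  set a := r%:C%C * w ^+ j; set t1 := h%:C%C * w ^+ j.
  have na : cnorm a = r by rewrite nrw // ltW.
  have nt1 : cnorm t1 = h by rewrite nrw // ltW.
  have nt2 : cnorm ((w - 1) * a) = s * r by rewrite cnormM na.
  have r1 : r <= 1 by lra.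
  have [|L HL H] := Hphi a; first by rewrite na.
  have ct2 : c * ((w - 1) * a) = t1.
    have -> : c * ((w - 1) * a) = (h / r * r)%:C%C * w ^+ j.
      by rewrite (rmorphM (real_complex R) (h / r) r) /c mulrA divfK ?subr_eq0 // /a mulrA.
    by rewrite divfK // gt_eqF.
  have E1 : cnorm (phi (a + t1) - phi a - t1 * L) <= A * h + B * h ^+ 2.
    rewrite -nt1; apply: H; first by rewrite nt1.
    by rewrite /a /t1 -mulrDl -rmorphD nrw //; lra.
  have E2 : cnorm (phi (a + (w - 1) * a) - phi a - (w - 1) * a * L)
            <= A * (s * r) + B * (s * r) ^+ 2.
    rewrite -nt2; apply: H.
      by rewrite nt2; apply: le_trans wt; rewrite ler_piMr // ltW.
    have -> : a + (w - 1) * a = w * a by ring.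
    by rewrite cnormM nw na mul1r.
  have -> : phi (a + t1) - phi a - c * (phi (a + (w - 1) * a) - phi a) =
     (phi (a + t1) - phi a - t1 * L) -
     c * (phi (a + (w - 1) * a) - phi a - (w - 1) * a * L).
    by rewrite -ct2; ring.
  have cE2 := cnormM_le (lexx (cnorm c)) E2.
  apply: le_trans (cnormB_le E1 cE2) _.
  have -> : cnorm c * (A * (s * r) + B * (s * r) ^+ 2) = h * (A + B * (s * r)).
    by rewrite -nc; ring.
  have : B * (s * r) <= B * s.
    by rewrite ler_wpM2l // ler_piMr // ltW.
  move/(ler_wpM2l (ltW h0)); lra.
(* Telescoping over the radii 1/n, ..., k/n. [step] divides by the radius, so the first circle is
   treated directly by the expansion at 0, where [phi 0 = 0]; the resulting error of order 1/n
   vanishes as n grows. *)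
have tele (n k : nat) : 0 < n%:R * t0 -> 1 <= n%:R * t0 -> (0 < k <= n)%N ->
    cnorm (M (k%:R / n%:R)) <= k%:R / n%:R * (2 * A + B * (n%:R^-1 + s)) +
      (A + 2 * B) / n%:R.
  move=> np nt; have n0 : 0 < n%:R :> R by move: np; rewrite pmulr_lgt0.
  set h := n%:R^-1; have h0 : 0 < h by rewrite invr_gt0.
  have n1 : 1 <= n%:R :> R by rewrite ler1n -(ltr0n R).
  have h1 : h <= 1 by rewrite invf_le1.
  have ht : h <= t0 by rewrite -[h]mul1r ler_pdivrMr // mulrC.
  elim: k => [//|[_ _|k IH /andP[_ kn]]].
    rewrite mul1r; apply: cnorm_mean => j; set t := _ * _.
    have nt' : cnorm t = h by rewrite nrw // ltW.
    have [|L LB H] := Hphi 0; first by rewrite cnorm0.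
    have := H t; rewrite nt' add0r phi0 nt' subr0 => /(_ ht h1) Ht.
    have -> : phi t = (phi t - t * L) + t * L by ring.
    apply: le_trans (cnormD_le Ht (cnormM_le (lexx _) LB)) _; rewrite nt'.
    have : B * (h * h) <= B * h by rewrite ler_wpM2l // ler_piMr // ltW.
    have : 0 <= h * (2 * A + B * (h + s)).
      by rewrite mulr_ge0 ?addr_ge0 ?mulr_ge0 ?addr_ge0 // ltW.
    rewrite expr2; lra.
  have {}IH := IH (ltnW kn).
  have kh : 0 < k.+1%:R * h by rewrite mulr_gt0.
  have E : k.+2%:R * h = k.+1%:R * h + h by rewrite -natr1; ring.
  have := @step (k.+1%:R * h) h kh h0 ht; rewrite -E.
  have -> : k.+2%:R * h <= 1 by rewrite ler_pdivrMr // mul1r ler_nat.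
  move=> /(_ isT) st; rewrite -[M (k.+2%:R * h)](subrK (M (k.+1%:R * h))).
  apply: le_trans (cnormD_le st IH) _; rewrite E; lra.
have main (n : nat) : 0 < n%:R * t0 -> 1 <= n%:R * t0 ->
    cnorm (M 1) <= 2 * A + B * s + (A + 3 * B) / n%:R.
  move=> np nt; have n0 : 0 < n%:R :> R by move: np; rewrite pmulr_lgt0.
  have := @tele n n np nt; rewrite leqnn -(ltr0n R) n0 => /(_ isT).
  by rewrite divff ?gt_eqF // => /le_trans; apply; lra.
have -> : rmean N w phi = M 1.
  by rewrite /M /rmean; congr (_ / _); apply: eq_bigr => j _; rewrite mul1r.
apply/ler_addgt0Pr => e e0.
pose n := maxn (Num.bound ((A + 3 * B) / e)) (Num.bound t0^-1).
have Hn1 : (A + 3 * B) / e < n%:R.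
  apply: lt_le_trans (archi_boundP _) _; last by rewrite ler_nat leq_maxl.
  by apply: divr_ge0; lra.
have Hn2 : t0^-1 < n%:R.
  apply: lt_le_trans (archi_boundP _) _; last by rewrite ler_nat leq_maxr.
  by rewrite invr_ge0 ltW.
have n0 : 0 < n%:R :> R by apply: lt_trans Hn2; rewrite invr_gt0.
apply: le_trans (main n _ _) _.
- by rewrite mulr_gt0.
- by rewrite -ler_pdivrMr // mul1r ltW.
by rewrite lerD2l ler_pdivrMr // [e * _]mulrC -ler_pdivrMr // ltW.
Qed.

End Means.

(** * Cutting off the zeros of a polynomial *)

Section Expansions.
Variable R : realType.
Local Notation C := R[i].
Implicit Types (f g : C -> C) (B : R).

(** A second-order expansion at 0 with one bound for all coefficients. [T] restricts the increments
    to those for which a denominator stays away from 0. *)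
Definition qexp (T : C -> Prop) f B : Prop :=
  cnorm (f 0) <= B /\ exists2 L, cnorm L <= B & forall t, cnorm t <= 1 -> T t ->
    exists2 r, cnorm r <= B & f t = f 0 + t * L + t ^+ 2 * r.

Lemma qexp_ge0 T f B : qexp T f B -> 0 <= B.
Proof. by move=> [h _]; apply: le_trans (cnorm_ge0 _) h. Qed.

Lemma qexp_sub (T T' : C -> Prop) f B :
  (forall t, T' t -> T t) -> qexp T f B -> qexp T' f B.
Proof.
move=> TT [h [L LB H]]; split=> //; exists L => // t t1 Tt.
by apply: H => //; apply: TT.
Qed.

Lemma qexpD T f g B B' : qexp T f B -> qexp T g B' ->
  qexp T (fun t => f t + g t) (B + B').
Proof.
move=> [f0 [L LB H]] [g0 [L' LB' H']]; split; first exact: cnormD_le.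
exists (L + L'); first exact: cnormD_le.
move=> t t1 Tt; have [r rB ->] := H t t1 Tt; have [r' rB' ->] := H' t t1 Tt.
by exists (r + r'); [exact: cnormD_le | ring].
Qed.

(** The remainder of the product has six terms, each at most B B'. *)
Lemma qexpM T f g B B' : qexp T f B -> qexp T g B' ->
  qexp T (fun t => f t * g t) (6%:R * (B * B')).
Proof.
move=> fB gB; have B0 := qexp_ge0 fB; have B0' := qexp_ge0 gB.
have BB0 : 0 <= B * B' by rewrite mulr_ge0.
case: fB gB => [f0 [L LB H]] [g0 [L' LB' H']]; split.
  by apply: le_trans (cnormM_le f0 g0) _; lra.
exists (f 0 * L' + L * g 0).
  by apply: le_trans (cnormD_le (cnormM_le f0 LB') (cnormM_le LB g0)) _; lra.
move=> t t1 Tt; have [r rB ->] := H t t1 Tt; have [r' rB' ->] := H' t t1 Tt.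
have t2 : cnorm (t ^+ 2) <= 1.
  by rewrite cnormX -[leRHS](expr1n _ 2) lerXn2r ?nnegrE ?cnorm_ge0.
exists (L * L' + f 0 * r' + r * g 0 + t * (L * r') + t * (r * L')
        + t ^+ 2 * (r * r')); last by ring.
have -> : 6%:R * (B * B') = B * B' + B * B' + B * B' + 1 * (B * B')
  + 1 * (B * B') + 1 * (B * B') by ring.
by rewrite !(cnormD_le, cnormM_le).
Qed.

(** With V = 1 / f(0), the error of the approximation V - t L V^2 to 1 / f(t) is t^2 V^2 (L^2 - r
    f(0) + t L r) / f(t): three terms of size B^2 and three inverses. The constant sums the bounds
    for value, slope and remainder. *)
Lemma qexpV (T : C -> Prop) f B (m : R) : 0 < m -> 1 <= B -> m <= cnorm (f 0) ->
  (forall t, T t -> m <= cnorm (f t)) -> qexp T f B ->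
  qexp T (fun t => (f t)^-1) (m^-1 + B * m^-1 ^+ 2 + 3%:R * B ^+ 2 * m^-1 ^+ 3).
Proof.
move=> m0 B1 mf mft [f0 [L LB H]].
have M0 : 0 < m^-1 by rewrite invr_gt0.
have nz x : m <= cnorm x -> x != 0.
  by move=> mx; rewrite -cnorm_eq0 gt_eqF // (lt_le_trans m0).
have nV x : m <= cnorm x -> cnorm x^-1 <= m^-1.
  by move=> mx; rewrite Normc.normcV lef_pV2 // posrE (lt_le_trans m0).
set V := (f 0)^-1; have nV0 : cnorm V <= m^-1 by apply: nV.
have nV2 : cnorm (V ^+ 2) <= m^-1 ^+ 2.
  by rewrite cnormX lerXn2r ?nnegrE ?cnorm_ge0 // ltW.
have p2 : 0 <= B * m^-1 ^+ 2 by rewrite mulr_ge0 ?exprn_ge0 ?ltW; lra.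
have p3 : 0 <= 3%:R * B ^+ 2 * m^-1 ^+ 3.
  by rewrite !mulr_ge0 ?exprn_ge0 ?ltW; lra.
split; first by apply: le_trans nV0 _; lra.
exists (- (L * V ^+ 2)).
  by rewrite cnormN; apply: le_trans (cnormM_le LB nV2) _; lra.
move=> t t1 Tt; have [r rB Et] := H t t1 Tt.
have := nV _ (mft t Tt); have := nz _ (mft t Tt).
set V' := (f t)^-1 => ft0 nV'.
exists ((- (r * f 0) + L * L + t * (L * r)) * V ^+ 2 * V').
  have -> : m^-1 + B * m^-1 ^+ 2 + 3%:R * B ^+ 2 * m^-1 ^+ 3 =
    (B * B + B * B + 1 * (B * B)) * m^-1 ^+ 2 * m^-1 + (m^-1 + B * m^-1 ^+ 2).
    by ring.
  rewrite -[leLHS]addr0 lerD //; last lra.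
  by rewrite !(cnormD_le, cnormM_le, cnormN).
have f00 := nz _ mf; rewrite /V /V'; rewrite Et in ft0 *.
by field; rewrite ft0 f00.
Qed.

End Expansions.

(** * A Lipschitz cut-off and the defect of holomorphy that it causes *)

Section Cutoff.
Variable R : realType.
Local Notation C := R[i].

(** Rises linearly from 0 at 1/6 to 1 at 1/3. If it differs at two points at most 1/12 apart, both
    lie in [1/12, 1/2]: away from the zeros of g, and where P is small. *)
Definition clamp (x : R) : R := Num.min 1 (Num.max 0 (6%:R * x - 1)).

Lemma clampP (x : R) : [\/ x <= 6^-1 /\ clamp x = 0, 3^-1 <= x /\ clamp x = 1 |
   6^-1 <= x <= 3^-1 /\ clamp x = 6%:R * x - 1].
Proof.
rewrite /clamp; case: (leP x 6^-1) => h1.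
  constructor 1; split=> //; rewrite (max_idPl _); last lra.
  by apply/min_idPr; rewrite ler01.
rewrite (max_idPr _); last lra.
case: (leP 3^-1 x) => h2.
  by constructor 2; split=> //; apply/min_idPl; lra.
by constructor 3; split; [lra | apply/min_idPr; lra].
Qed.

Lemma clamp_ge0 x : 0 <= clamp x.
Proof. by have [[]|[]|[]] := clampP x => h ->; lra. Qed.

Lemma clamp_le1 x : clamp x <= 1.
Proof. by have [[]|[]|[]] := clampP x => h ->; lra. Qed.

Lemma clamp_lipschitz x y : `|clamp x - clamp y| <= 6%:R * `|x - y|.
Proof.
have h := ler_norm (x - y); have := ler_norm (y - x); rewrite distrC => h'.
rewrite ler_norml; have [[]|[]|[]] := clampP x => hx ->;
have [[]|[]|[]] := clampP y => hy ->; lra.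
Qed.

(** The constant of [qexpM] and [qexpV] for P / g when |g| >= 1/12. *)
Definition cutoff_const (Bg BP : R) : R :=
  6%:R * (BP * (12 + Bg * 12 ^+ 2 + 3%:R * Bg ^+ 2 * 12 ^+ 3)).

(** Only the variation of the cut-off spoils holomorphy. The cut-off is 6-Lipschitz, g varies by at
    most 2 Bg |t|, and where the cut-off varies |P| <= e and |1 / g| <= 12, whence 144 = 6 . 2 . 12.
    The radius 1 / (24 Bg) keeps the change of Re g below 1/12. *)
Lemma cutoff_almost_holomorphic (g P : C -> C) (Bg BP e : R) :
  1 <= Bg -> 0 <= e ->
  (forall a, cnorm a <= 1 -> qexp (fun=> True) (fun t => g (a + t)) Bg) ->
  (forall a, cnorm a <= 1 -> qexp (fun=> True) (fun t => P (a + t)) BP) ->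
  (forall a, cnorm a <= 1 -> complex.Re (g a) <= 2^-1 -> cnorm (P a) <= e) ->
  let phi a := (clamp (complex.Re (g a)))%:C%C * (P a / g a) in
  forall a, cnorm a <= 1 ->
  exists2 L : C, cnorm L <= cutoff_const Bg BP &
    forall t, cnorm t <= (24 * Bg)^-1 -> cnorm (a + t) <= 1 ->
    cnorm (phi (a + t) - phi a - t * L) <=
      144%:R * Bg * e * cnorm t + cutoff_const Bg BP * cnorm t ^+ 2.
Proof.
move=> Bg1 e0 gB PB Pe phi a a1; set K := cutoff_const Bg BP.
have Bg0 : 0 < Bg by lra.
have BP0 : 0 <= BP := qexp_ge0 (PB a a1).
have K0 : 0 <= K.
  by rewrite !mulr_ge0 // !addr_ge0 // !mulr_ge0 ?exprn_ge0 // ltW.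
have A0 : 0 <= 144%:R * Bg * e by rewrite !mulr_ge0 // ltW.
have small t : cnorm t <= (24 * Bg)^-1 -> cnorm t <= 1.
  by move=> h; apply: le_trans h _; rewrite invf_le1 ?mulr_gt0 //; lra.
have dg t : cnorm t <= 1 -> cnorm (g (a + t) - g a) <= 2%:R * Bg * cnorm t.
  move=> t1; have [_ [L LB H]] := gB a a1.
  have [r rB] := H t t1 I; rewrite addr0 => ->.
  have -> : g a + t * L + t ^+ 2 * r - g a = t * L + t * (t * r) by ring.
  apply: le_trans (cnormD_le (cnormM_le (lexx _) LB)
    (cnormM_le (lexx _) (cnormM_le t1 rB))) _; lra.
have dRe t : cnorm t <= 1 ->
    `|complex.Re (g (a + t)) - complex.Re (g a)| <= 2%:R * Bg * cnorm t.
  by move=> t1; rewrite -raddfB; apply: le_trans (Re_le_cnorm _) (dg t t1).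
have dRe12 t : cnorm t <= (24 * Bg)^-1 ->
    `|complex.Re (g (a + t)) - complex.Re (g a)| <= 12^-1.
  move=> h; apply: le_trans (dRe t (small t h)) _.
  have -> : 12^-1 = 2%:R * Bg * (24 * Bg)^-1 by field; rewrite gt_eqF.
  by rewrite ler_wpM2l // mulr_ge0 // ltW.
have lower (z : C) : 12^-1 <= complex.Re z -> 12^-1 <= cnorm z.
  move=> h; apply: le_trans h _.
  by apply: le_trans (ler_norm _) (Re_le_cnorm _).
(* The increment of the cut-off only matters where Re g <= 1 / 2. *)
have jump t : cnorm t <= (24 * Bg)^-1 -> cnorm (a + t) <= 1 ->
    cnorm (((clamp (complex.Re (g (a + t))))%:C%C - (clamp (complex.Re (g a)))%:C%C)
      * (P (a + t) / g (a + t))) <= 144%:R * Bg * e * cnorm t.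
  move=> ts at1; have := dRe12 t ts; have := dRe t (small t ts).
  set x := complex.Re (g (a + t)); set y := complex.Re (g a) => d1 d2.
  have [E|ne] := eqVneq (clamp x) (clamp y).
    by rewrite E subrr mul0r cnorm0 mulr_ge0 ?cnorm_ge0.
  have [x1 x2] : 12^-1 <= x /\ x <= 2^-1.
    move: d2 ne; rewrite ler_norml; have [[]|[]|[]] := clampP x => hx ->;
    have [[]|[]|[]] := clampP y => hy ->; rewrite ?eqxx // => d2 _; lra.
  have -> : 144%:R * Bg * e * cnorm t = 6%:R * (2%:R * Bg * cnorm t) * (e * 12).
    by ring.
  apply: cnormM_le.
    rewrite -rmorphB cnormC; apply: le_trans (clamp_lipschitz _ _) _.
    by rewrite ler_wpM2l.
  apply: cnormM_le; first exact: Pe.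
  rewrite Normc.normcV -[leRHS]invrK lef_pV2 ?posrE ?invr_gt0 ?lower //.
  by have := lower _ x1; lra.
(* In the first case [phi a = 0] and the increment is all due to the cut-off, so [L = 0] works. In
   the second, Re g >= 1/12 for all small increments and P / g has an expansion. *)
case: (leP (complex.Re (g a)) 6^-1) => ga.
  exists 0; first by rewrite cnorm0.
  move=> t ts at1; rewrite mulr0 subr0.
  have ca : clamp (complex.Re (g a)) = 0.
    have [[]|[]|[]] := clampP (complex.Re (g a)) => // hy ->; lra.
  have := jump t ts at1; rewrite /phi ca mul0r !subr0 => /le_trans; apply.
  by rewrite lerDl mulr_ge0 ?exprn_ge0 ?cnorm_ge0.
pose T t : Prop := cnorm t <= (24 * Bg)^-1.
have gT t : T t -> 12^-1 <= cnorm (g (a + t)).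
  by move=> /dRe12; rewrite ler_norml => d; apply: lower; lra.
have T0 : T 0 by rewrite /T cnorm0 invr_ge0 mulr_ge0 // ltW.
have [_ [L LB H]] : qexp T (fun t => P (a + t) / g (a + t)) K.
  have -> : K = 6%:R * (BP * (12^-1^-1 + Bg * 12^-1^-1 ^+ 2
      + 3%:R * Bg ^+ 2 * 12^-1^-1 ^+ 3)) by rewrite !invrK.
  apply: qexpM; first exact: qexp_sub (PB a a1).
  apply: qexpV; rewrite ?invr_gt0 //; first exact: gT.
  exact: qexp_sub (gB a a1).
set c := (clamp (complex.Re (g a)))%:C%C.
have nc : cnorm c <= 1 by rewrite cnormC ger0_norm ?clamp_ge0 ?clamp_le1.
exists (c * L); first by rewrite -[leRHS]mul1r cnormM_le.
move=> t ts at1; have [r rK Et] := H t (small t ts) ts.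
have -> : phi (a + t) - phi a - t * (c * L) =
   ((clamp (complex.Re (g (a + t))))%:C%C - c) * (P (a + t) / g (a + t))
   + c * (t ^+ 2 * r).
  rewrite /phi -/c mulrBl Et addr0; ring.
apply: cnormD_le; first exact: jump.
rewrite -[leRHS]mul1r; apply: cnormM_le => //.
by rewrite mulrC cnormM_le // cnormX.
Qed.

End Cutoff.

(** * Polynomial functions of two complex variables *)

Section PolyFun.
Variable R : realType.
Local Notation C := R[i].
Implicit Types f g h : C -> C -> C.

(** Curried, so that either variable can be frozen, and inductive, so that expansions and
    decompositions follow the construction of the function. *)
Inductive polyfun : (C -> C -> C) -> Prop :=
| polyfun_const c : polyfun (fun _ _ => c)
| polyfun_fst : polyfun (fun a _ => a)
| polyfun_snd : polyfun (fun _ b => b)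
| polyfunD f g : polyfun f -> polyfun g -> polyfun (fun a b => f a b + g a b)
| polyfunM f g : polyfun f -> polyfun g -> polyfun (fun a b => f a b * g a b).

Lemma polyfunX f n : polyfun f -> polyfun (fun a b => f a b ^+ n).
Proof.
move=> fp; elim: n => [|n IH]; first exact: polyfun_const.
have -> : (fun a b => f a b ^+ n.+1) = (fun a b => f a b * f a b ^+ n).
  by apply/funext => a; apply/funext => b; rewrite exprS.
exact: polyfunM.
Qed.

Lemma polyfunB f g : polyfun f -> polyfun g -> polyfun (fun a b => f a b - g a b).
Proof.
move=> fp gp; apply: polyfunD => //.
have -> : (fun a b => - g a b) = (fun a b => -1 * g a b).
  by apply/funext => a; apply/funext => b; rewrite mulN1r.
by apply: polyfunM => //; apply: polyfun_const.
Qed.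

Lemma polyfun_flip f : polyfun f -> polyfun (fun a b => f b a).
Proof.
elim=> [c||| f' g _ fp _ gp| f' g _ fp _ gp].
- exact: polyfun_const.
- exact: polyfun_snd.
- exact: polyfun_fst.
- exact: polyfunD.
- exact: polyfunM.
Qed.

Lemma polyfun_qexp f : polyfun f -> exists2 B : R, 1 <= B &
  forall a b, cnorm a <= 1 -> cnorm b <= 1 ->
    qexp (fun=> True) (fun t => f (a + t) b) B.
Proof.
have weak (T : C -> Prop) u (B B' : R) : B <= B' -> qexp T u B -> qexp T u B'.
  move=> BB [u0 [L LB H]]; split; first exact: le_trans BB.
  exists L => [|t t1 Tt]; first exact: le_trans BB.
  by have [r rB E] := H t t1 Tt; exists r => //; apply: le_trans BB.
have cst (c b : C) (B : R) : cnorm c <= B -> qexp (fun=> True) (fun=> c) B.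
  move=> cB; have B0 := le_trans (cnorm_ge0 _) cB.
  split=> //; exists 0; rewrite ?cnorm0 // => t _ _.
  by exists 0; rewrite ?cnorm0 // !mulr0 !addr0.
elim=> [c||| {}f g _ [B B1 fB] _ [B' B1' gB]| {}f g _ [B B1 fB] _ [B' B1' gB]].
- exists (cnorm c + 1); first by rewrite lerDr cnorm_ge0.
  by move=> a b _ _; apply: cst => //; rewrite lerDl.
- exists 1 => // a b a1 _; split; first by rewrite addr0.
  exists 1; rewrite ?cnorm1 // => t _ _.
  by exists 0; rewrite ?cnorm0 ?ler01 // mulr1 mulr0 !addr0.
- by exists 1 => // a b _ b1; apply: cst.
- exists (B + B'); first lra.
  by move=> a b a1 b1; apply: qexpD; [exact: fB | exact: gB].
exists (6%:R * (B * B')); last first.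
  by move=> a b a1 b1; apply: qexpM; [exact: fB | exact: gB].
have : 1 <= B * B' by rewrite mulr_ege1.
lra.
Qed.

(** The factors [a] and [b] make each summand vanish when its own variable is 0, as the mean value
    estimate in that variable requires. *)
Lemma polyfun_decomp f : polyfun f -> exists c d, [/\ polyfun c, polyfun d &
  forall a b, f a b = f 0 0 + a * c a b + b * d a b].
Proof.
pose cst := polyfun_const.
elim=> [c||| {}f g fp [c [d [cp dp E]]] gp [c' [d' [cp' dp' E']]]
  | {}f g fp [c [d [cp dp E]]] gp [c' [d' [cp' dp' E']]]].
- by exists (fun _ _ => 0), (fun _ _ => 0); split=> // *; rewrite !mulr0 !addr0.
- exists (fun _ _ => 1), (fun _ _ => 0); split=> // *.
  by rewrite mulr0 mulr1 add0r addr0.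
- exists (fun _ _ => 0), (fun _ _ => 1); split=> // *.
  by rewrite mulr0 mulr1 !add0r.
- exists (fun a b => c a b + c' a b), (fun a b => d a b + d' a b).
  by split=> [||a b]; [exact: polyfunD | exact: polyfunD | rewrite E E'; ring].
exists (fun a b => c a b * g a b + f 0 0 * c' a b),
       (fun a b => d a b * g a b + f 0 0 * d' a b).
split=> [||a b]; try by do ?[apply: polyfunD | apply: polyfunM | apply: cst].
by rewrite (E a b) (E' a b); ring.
Qed.

End PolyFun.

(** * The hull estimate, by means over the torus *)

Section TorusMeans.
Variable R : realType.
Local Notation C := R[i].
Implicit Types f g h : C -> C -> C.

Local Notation unity N w := [/\ w ^+ N.+1 = 1, w != 1 & cnorm w = 1].

(** The substitute for h / g; it is 0 wherever Re g <= 1/6, in particular at the zeros of g. *)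
Definition cutquot g h (a b : C) : C :=
  (clamp (complex.Re (g a b)))%:C%C * (h a b / g a b).

(** The coefficient of [e] depends on [g] and [c] only. [B] also depends on [h], which will be a
    power of p, but it multiplies |w - 1|, which can be made small once [h] is fixed. *)
Lemma mean_cutquot g c h (Bg Bc e : R) : polyfun g -> polyfun c -> polyfun h ->
  1 <= Bg -> 1 <= Bc -> 0 <= e ->
  (forall a b, cnorm a <= 1 -> cnorm b <= 1 ->
    qexp (fun=> True) (fun t => g (a + t) b) Bg) ->
  (forall a b, cnorm a <= 1 -> cnorm b <= 1 -> cnorm (c a b) <= Bc) ->
  (forall a b, cnorm a <= 1 -> cnorm b = 1 ->
    complex.Re (g a b) <= 2^-1 -> cnorm (h a b) <= e) ->
  exists2 B : R, 0 <= B & forall N w b, unity N w ->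
    cnorm (w - 1) <= (24%:R * Bg)^-1 -> cnorm b = 1 ->
    cnorm (rmean N w (fun a => a * c a b * cutquot g h a b))
      <= 288%:R * Bg * Bc * e + B * cnorm (w - 1).
Proof.
move=> gp cp hp Bg1 Bc1 e0 gB cB he.
have [BP BP1 PB] := polyfun_qexp (polyfunM (polyfunM (polyfun_fst R) cp) hp).
have Bg0 : 0 < Bg by lra.
have Bc0 : 0 < Bc by lra.
exists (cutoff_const Bg BP).
  by rewrite /cutoff_const !mulr_ge0 // ?addr_ge0 // ?mulr_ge0 ?exprn_ge0; lra.
move=> N w b [wN w1 nw] wt b1.
pose P a := a * c a b * h a b.
pose phi a := (clamp (complex.Re (g a b)))%:C%C * (P a / g a b).
have -> : rmean N w (fun a => a * c a b * cutquot g h a b) = rmean N w phi.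
  by congr (_ / _); apply: eq_bigr => j _; rewrite /phi /cutquot /P; ring.
have -> : 288%:R * Bg * Bc * e = 2 * (144%:R * Bg * (Bc * e)) by ring.
apply: (mean_almost_holomorphic (t0 := (24%:R * Bg)^-1)) => //.
- by rewrite !mulr_ge0 // ltW.
- by rewrite /cutoff_const !mulr_ge0 // ?addr_ge0 // ?mulr_ge0 ?exprn_ge0; lra.
- by rewrite invr_gt0 mulr_gt0.
- by rewrite /phi /P !mul0r mulr0.
apply: (@cutoff_almost_holomorphic _ (g ^~ b) P) => //.
- by rewrite mulr_ge0 // ltW.
- by move=> a a1; apply: gB; rewrite // b1.
- by move=> a a1; apply: PB; rewrite // b1.
move=> a a1 ga; apply: cnormM_le; last exact: he.
by rewrite -[leRHS]mul1r cnormM_le // cB // b1.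
Qed.

(** The mean value property up to the mesh of the discrete circle: the holomorphic case, with defect
    A = 0. *)
Lemma mean_polyfun c : polyfun c -> exists2 B : R, 0 <= B &
  forall N w b, unity N w -> cnorm (w - 1) <= 1 -> cnorm b = 1 ->
  cnorm (rmean N w (fun a => a * c a b)) <= B * cnorm (w - 1).
Proof.
move=> cp; have [B B1 PB] := polyfun_qexp (polyfunM (polyfun_fst R) cp).
have B0 : 0 <= B by lra.
exists B => // N w b [wN w1 nw] wt b1.
rewrite -[leRHS]add0r -[0](mulr0 2).
apply: (mean_almost_holomorphic (t0 := 1)) => //; first by rewrite mul0r.
move=> a a1; have [|_ [L LB H]] := PB a b a1; first by rewrite b1.
exists L => // t t1 _; have [r rB ->] := H t t1 I.
rewrite addr0 mul0r add0r [B * _]mulrC -cnormX.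
have -> : a * c a b + t * L + t ^+ 2 * r - a * c a b - t * L = t ^+ 2 * r by ring.
exact: cnormM_le.
Qed.

Definition tmean N w f : C := rmean N w (fun b => rmean N w (f ^~ b)).

Lemma tmean_flip N w f : tmean N w f = tmean N w (fun a b => f b a).
Proof.
rewrite /tmean /rmean -!mulr_suml exchange_big /=.
by congr (_ / _ / _).
Qed.

Lemma tmeanD N w f g :
  tmean N w (fun a b => f a b + g a b) = tmean N w f + tmean N w g.
Proof.
rewrite /tmean /rmean -mulrDl -big_split /=; congr (_ / _).
by apply: eq_bigr => j _; rewrite -mulrDl -big_split.
Qed.

Lemma cnorm_tmean N w f (B : R) : cnorm w = 1 ->
  (forall b, cnorm b = 1 -> cnorm (rmean N w (f ^~ b)) <= B) ->
  cnorm (tmean N w f) <= B.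
Proof.
move=> nw H; apply: cnorm_mean => j; apply: H.
by rewrite cnormX nw expr1n.
Qed.

Lemma cnorm_rmean N w (f : C -> C) (B : R) : cnorm w = 1 ->
  (forall a, cnorm a = 1 -> cnorm (f a) <= B) -> cnorm (rmean N w f) <= B.
Proof.
move=> nw H; apply: cnorm_mean => j; apply: H.
by rewrite cnormX nw expr1n.
Qed.

Lemma rmean_const N w (c : C) : rmean N w (fun=> c) = c.
Proof. by rewrite /rmean sumr_const card_ord -[c *+ _]mulr_natr mulfK ?pnatr_eq0. Qed.

Lemma tmean_const N w c : tmean N w (fun _ _ => c) = c.
Proof. exact: etrans (rmean_const N w _) (rmean_const N w c). Qed.

(* With g = 1 - F and u = chi(Re g) p^k / g, where chi cuts off the zeros of g,
   p^k - g u is bounded by eta^k on the torus, and g u = z c u + w d u has a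
   mean of order eta^k there because u is almost holomorphic in each variable
   when the other one has modulus 1. Hence |p(0)|^k <= K eta^k for all k, with
   K independent of k. *)
Lemma polyfun_hull F p (eta : R) : polyfun F -> polyfun p -> F 0 0 = 1 ->
  0 <= eta ->
  (forall a b, cnorm a <= 1 -> cnorm b <= 1 -> cnorm a = 1 \/ cnorm b = 1 ->
     2^-1 <= complex.Re (F a b) -> cnorm (p a b) <= eta) ->
  cnorm (p 0 0) <= eta.
Proof.
move=> Fp pp F0 eta0 Hp.
pose g a b := 1 - F a b.
have gp : polyfun g by apply: polyfunB => //; apply: polyfun_const.
have [c [d [cp dp Eg]]] := polyfun_decomp gp.
have g0 : g 0 0 = 0 by rewrite /g F0 subrr.
have [Bg Bg1 gB] := polyfun_qexp gp.
have [Bg' Bg1' gB'] := polyfun_qexp (polyfun_flip gp).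
have [Bc Bc1 cB] := polyfun_qexp cp.
have [Bd Bd1 dB] := polyfun_qexp dp.
have small a b : cnorm a <= 1 -> cnorm b <= 1 -> cnorm a = 1 \/ cnorm b = 1 ->
    complex.Re (g a b) <= 2^-1 -> cnorm (p a b) <= eta.
  move=> a1 b1 ab; rewrite /g raddfB /= => h; apply: Hp => //; lra.
clearbody g.
(* Fixed before [k]. The summands account for [h - g u], [a c u] and [b d u], where u is
   [cutquot g h]. *)
pose K : R := 1 + 288%:R * Bg * Bc + 288%:R * Bg' * Bd.
apply: (@exp_domination R _ _ K) => // [|k]; first exact: cnorm_ge0.
rewrite -cnormX; pose h a b := p a b ^+ k.
have hp : polyfun h := polyfunX k pp.
have ek0 : 0 <= eta ^+ k by rewrite exprn_ge0.
have hsmall a b : cnorm a <= 1 -> cnorm b <= 1 -> cnorm a = 1 \/ cnorm b = 1 ->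
    complex.Re (g a b) <= 2^-1 -> cnorm (h a b) <= eta ^+ k.
  move=> a1 b1 ab ga; rewrite cnormX lerXn2r ?nnegrE ?cnorm_ge0 //.
  exact: small.
have [c' [d' [cp' dp' Eh]]] := polyfun_decomp hp.
have [B1 B10 M1] : exists2 B : R, 0 <= B & forall N w b, unity N w ->
    cnorm (w - 1) <= (24%:R * Bg)^-1 -> cnorm b = 1 ->
    cnorm (rmean N w (fun a => a * c a b * cutquot g h a b))
      <= 288%:R * Bg * Bc * eta ^+ k + B * cnorm (w - 1).
  apply: mean_cutquot => // [a b a1 b1|a b a1 b1].
    by have [] := cB a b a1 b1; rewrite addr0.
  by apply: hsmall; rewrite ?b1 //; right.
have [B2 B20 M2] : exists2 B : R, 0 <= B & forall N w b, unity N w ->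
    cnorm (w - 1) <= (24%:R * Bg')^-1 -> cnorm b = 1 ->
    cnorm (rmean N w (fun a => a * d b a * cutquot g h b a))
      <= 288%:R * Bg' * Bd * eta ^+ k + B * cnorm (w - 1).
  apply: (@mean_cutquot (fun a b => g b a) (fun a b => d b a)
    (fun a b => h b a)) => //; try exact: polyfun_flip.
    by move=> a b a1 b1; have [] := dB b a b1 a1; rewrite addr0.
  by move=> a b a1 b1; apply: hsmall; rewrite ?b1 //; left.
have [B3 B30 M3] := mean_polyfun cp'.
have [B4 B40 M4] := mean_polyfun (polyfun_flip dp').
apply/ler_addgt0Pr => e e0.
(* The mesh is admissible for [M1] and [M2], and small enough for all the errors that depend on [k]
   to sum to at most [e]. *)
pose t := Num.min (Num.min (24%:R * Bg)^-1 (24%:R * Bg')^-1)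
  (e / (B1 + B2 + B3 + B4 + 1)).
have BB : 0 < B1 + B2 + B3 + B4 + 1 by lra.
have t0 : 0 < t by rewrite !lt_min divr_gt0 // !invr_gt0 !mulr_gt0 //; lra.
have [N [w [wN w1 nw wt]]] := root_of_unity_near1 t0.
have U : unity N w by [].
move: wt; rewrite !lt_min => /andP[/andP[/ltW wt1 /ltW wt2] /ltW wt3].
have wt4 : cnorm (w - 1) <= 1.
  by apply: le_trans wt1 _; rewrite invf_le1; lra.
(* A constant is its own mean; h(0) = h - a c' - b d', and g u is subtracted and added back as a c u
   + b d u. *)
have E : h 0 0 = tmean N w (fun a b => (h a b - g a b * cutquot g h a b)
   + a * c a b * cutquot g h a b + b * d a b * cutquot g h a b
   + - (a * c' a b) + - (b * d' a b)).
  rewrite -[LHS](tmean_const N w); congr rmean; apply/funext => b.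
  congr rmean; apply/funext => a.
  by rewrite [in RHS]Eh [g a b]Eg g0; ring.
rewrite -/(h 0 0) E 4!tmeanD.
have T1 : cnorm (tmean N w (fun a b => h a b - g a b * cutquot g h a b))
    <= eta ^+ k.
  apply: cnorm_tmean => // b b1; apply: cnorm_rmean => // a a1.
  set x := clamp (complex.Re (g a b)).
  (* The identity h - g u = (1 - x) h, whose right side lives where Re g <= 1/3, must also hold at
     the zeros of g, where the formal quotient is 0. *)
  have gz : g a b = 0 -> x = 0.
    move=> z; rewrite /x z; have [[]|[]|[]] := clampP (0 : R) => /= h1 //; lra.
  have -> : h a b - g a b * cutquot g h a b = (1 - x)%:C%C * h a b.
    rewrite /cutquot -/x (rmorphB (real_complex R)) rmorph1.
    rewrite [RHS]mulrBl mul1r; congr (_ - _).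
    have [/[dup] /gz -> ->|nz] := eqVneq (g a b) 0; first by rewrite !mul0r.
    by field.
  have [[]|[]|[]] := clampP (complex.Re (g a b)); rewrite -/x => h1 Ex.
  - rewrite Ex subr0 mul1r; apply: hsmall; rewrite ?a1 ?b1 //; last lra.
    by left.
  - by rewrite Ex subrr mul0r cnorm0.
  rewrite -[leRHS]mul1r; apply: cnormM_le.
    by rewrite cnormC ler_norml; lra.
  by apply: hsmall; rewrite ?a1 ?b1 //; [left | lra].
have T2 := cnorm_tmean nw (fun b b1 => M1 N w b U wt1 b1).
have T3 := cnorm_tmean nw (fun b b1 => M2 N w b U wt2 b1).
have T4 : cnorm (tmean N w (fun a b => - (a * c' a b))) <= B3 * cnorm (w - 1).
  apply: cnorm_tmean => // b b1.
  by rewrite /rmean sumrN mulNr cnormN; apply: M3.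
have T5 : cnorm (tmean N w (fun a b => - (a * d' b a))) <= B4 * cnorm (w - 1).
  apply: cnorm_tmean => // b b1.
  by rewrite /rmean sumrN mulNr cnormN; apply: M4.
rewrite tmean_flip in T3; rewrite tmean_flip in T5.
apply: le_trans (cnormD_le (cnormD_le (cnormD_le (cnormD_le T1 T2) T3) T4) T5) _.
have : (B1 + B2 + B3 + B4 + 1) * cnorm (w - 1) <= e by rewrite mulrC -ler_pdivlMr.
have := cnorm_ge0 (w - 1); rewrite /K; lra.
Qed.

End TorusMeans.

(** * Topology of the bidisk *)

Section ComplexTopology.
Variable R : realType.
Local Notation C := R[i].

(** The radii of balls in [R[i]] are elements of [R[i]]; being positive they are real, which allows
    real radii here. *)
Lemma nbhs_cnormP (z : C) (A : set C) :
  nbhs z A <-> exists2 e : R, 0 < e & forall y, cnorm (z - y) < e -> A y.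
Proof.
split=> [/nbhs_ballP [e /= e0 H]|[e e0 H]].
  have eE : e = (complex.Re e)%:C%C by rewrite RRe_real ?gtr0_real.
  rewrite eE in e0 H; exists (complex.Re e); first by rewrite -ltcR.
  by move=> y zy; apply: H; rewrite -ball_normE /= normcE ltcR.
apply/nbhs_ballP; exists e%:C%C; first by rewrite /= ltcR.
by move=> y; rewrite -ball_normE /= normcE ltcR; apply: H.
Qed.

Lemma cnorm_lipschitz (x y : C) : `|cnorm x - cnorm y| <= cnorm (x - y).
Proof.
have h a b : cnorm a - cnorm b <= cnorm (a - b) :> R.
  by rewrite lerBlDr -{1}(subrK b a) le_normcD.
rewrite ler_norml h andbT lerNl opprB -[leRHS]cnormN opprB; exact: h.
Qed.

Lemma lipschitz_continuous (f : C -> R) :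
  (forall x y, `|f x - f y| <= cnorm (x - y)) -> continuous f.
Proof.
move=> H x A /nbhs_ballP [e /= e0 HA]; apply/nbhs_cnormP; exists e => // y xy.
by apply: HA; rewrite -ball_normE; apply: le_lt_trans (H x y) xy.
Qed.

Lemma cnorm_continuous : continuous (@Normc.normc R : C -> R).
Proof. exact/lipschitz_continuous/cnorm_lipschitz. Qed.

Lemma Re_continuous : continuous (@complex.Re R).
Proof.
apply: lipschitz_continuous => x y.
by rewrite -(raddfB (@complex.Re R : Rcomplex R -> R)) Re_le_cnorm.
Qed.

Lemma Complex_continuous : continuous (fun u : R * R => Complex u.1 u.2).
Proof.
move=> [x y] A /nbhs_cnormP [e e0 HA].
have e20 : 0 < e / 2 by lra.
apply/nbhs_ballP; exists (e / 2) => //= -[x' y'] [/=].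
rewrite -!ball_normE /= => hx hy; apply: HA.
have -> : Complex x y - Complex x' y' = (x - x')%:C%C + (Complex 0 1) * (y - y')%:C%C.
  by apply/eqP; rewrite eq_complex /=; apply/andP; split; apply/eqP; ring.
apply: le_lt_trans (le_normcD _ _) _.
rewrite cnormM !cnormC /= expr0n expr1n add0r sqrtr1 mul1r; lra.
Qed.

Lemma ccontinuousD (T : topologicalType) (f g : T -> C) :
  continuous f -> continuous g -> continuous (fun x => f x + g x).
Proof. by move=> cf cg x; apply: cvgD; [exact: cf | exact: cg]. Qed.

Lemma ccontinuousM (T : topologicalType) (f g : T -> C) :
  continuous f -> continuous g -> continuous (fun x => f x * g x).
Proof. by move=> cf cg x; apply: cvgM; [exact: cf | exact: cg]. Qed.

Lemma compact_cdisk : compact [set z : C | cnorm z <= 1].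
Proof.
apply: (@subclosed_compact _ _
  ((fun u : R * R => Complex u.1 u.2) @` (`[-1, 1] `*` `[-1, 1]))).
- have /continuous_closedP := cnorm_continuous.
  by move=> /(_ _ (@closed_le _ 1)).
- apply: continuous_compact; last by apply: compact_setX; exact: segment_compact.
  by apply: continuous_subspaceT; exact: Complex_continuous.
move=> z /= z1; exists (complex.Re z, complex.Im z); last by case: z {z1}.
have := sqr_cnorm z; have := cnorm_ge0 z => z0 E.
rewrite /= !in_itv /=; split; apply/andP; split; nra.
Qed.

Lemma compact_closed_bidisk : compact (closed_bidisk R).
Proof. exact: (@rV_compact _ 2 (fun=> [set z : C | cnorm z <= 1]) (fun=> compact_cdisk)). Qed.

End ComplexTopology.

(** * Polynomials as functions *)

Section Peval.
Variables (R : realType) (n : nat).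
Local Notation C := R[i].
Implicit Types (p q : mpoly.mpoly n C) (z : 'rV[C]_n).

Lemma pevalD p q z : peval (p + q) z = peval p z + peval q z.
Proof. exact: mpoly.mevalD. Qed.
Lemma pevalB p q z : peval (p - q) z = peval p z - peval q z.
Proof. exact: mpoly.mevalB. Qed.
Lemma pevalM p q z : peval (p * q) z = peval p z * peval q z.
Proof. exact: mpoly.mevalM. Qed.
Lemma peval1 z : peval 1 z = 1.
Proof. exact: mpoly.meval1. Qed.
Lemma pevalXn p k z : peval (p ^+ k) z = peval p z ^+ k.
Proof. by elim: k => [|k IH]; rewrite ?expr0 ?peval1 // !exprS pevalM IH. Qed.
Lemma pevalZ c p z : peval (c *: p) z = c * peval p z.
Proof. exact: mpoly.mevalZ. Qed.
Lemma peval_var i z : peval (mpoly.mpolyX C (mpoly.mnm1 i)) z = z ord0 i.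
Proof. exact: mpoly.mevalXU. Qed.
Lemma pevalC c z : peval (mpoly.mpolyC n c) z = c.
Proof. exact: mpoly.mevalC. Qed.

(** Induction on the function rather than on the formal polynomial; it serves for continuity, for
    [polyfun] and for the values of characters. *)
Lemma peval_ind (P : ('rV[C]_n -> C) -> Prop) :
  (forall c, P (fun=> c)) -> (forall i, P (fun z => z ord0 i)) ->
  (forall f g, P f -> P g -> P (fun z => f z + g z)) ->
  (forall f g, P f -> P g -> P (fun z => f z * g z)) -> forall p, P (peval p).
Proof.
move=> Pc PX PD PM; elim/mpoly.mpolyind => [|c m p _ _ IH].
  have -> : peval (0 : mpoly.mpoly n C) = (fun=> 0); last exact: Pc.
  by apply/funext => z; exact: mpoly.meval0.
have -> : peval (c *: mpoly.mpolyX C m + p) =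
   (fun z => c * (\prod_(i < n) z ord0 i ^+ m i) + peval p z).
  by apply/funext => z; rewrite pevalD pevalZ /peval mpoly.mevalX.
apply: (PD _ _) => //; apply: (PM (fun=> c)) => //.
have E (f g : 'rV[C]_n -> C) : f =1 g -> P f -> P g by move=> /funext ->.
elim: (index_enum 'I_n) => [|i s IHs].
  by apply: (E (fun=> 1)) => // z; rewrite big_nil.
apply: (E (fun z => z ord0 i ^+ m i * \prod_(j <- s) z ord0 j ^+ m j)).
  by move=> z; rewrite big_cons.
apply: (PM _ _) => //; elim: {IHs}(m i) => [|k IHk].
  by apply: (E (fun=> 1)) => // z; rewrite expr0.
apply: (E (fun z => z ord0 i * z ord0 i ^+ k)); last exact: PM.
by move=> z; rewrite exprS.
Qed.

Lemma peval_continuous p : continuous (peval p).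
Proof.
apply: (@peval_ind (fun f => continuous f)) p => [c|i|f g cf cg|f g cf cg] x.
- exact: cst_continuous.
- exact: coord_continuous.
- exact: (ccontinuousD cf cg).
- exact: (ccontinuousM cf cg).
Qed.

End Peval.

Section Bidisk.
Variable R : realType.
Local Notation C := R[i].
Implicit Types (p q : mpoly.mpoly 2 C) (z : 'rV[C]_2).

Lemma peval_polyfun p :
  polyfun (fun a b => peval p (\row_k (if k == ord0 then a else b))).
Proof.
pose P (f : 'rV[C]_2 -> C) := polyfun (fun a b : C => f (\row_k (if k == ord0 then a else b))).
suff : P (peval p) by [].
apply: (@peval_ind _ _ P) p => [c|i|f g|f g]; rewrite /P.
- exact: polyfun_const.
- have -> : (fun a b : C => (\row_k (if k == ord0 then a else b)) ord0 i) =
    if i == ord0 then (fun a _ => a) else (fun _ b => b).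
    by apply/funext => a; apply/funext => b; rewrite mxE; case: ifP.
  by case: ifP => _; [exact: polyfun_fst | exact: polyfun_snd].
- exact: polyfunD.
- exact: polyfunM.
Qed.

Definition bidisk_edge : set 'rV[C]_2 :=
  [set z | closed_bidisk R z /\ exists i, cnorm (z ord0 i) = 1].

Lemma edge_hull (F p : mpoly.mpoly 2 C) (eta : R) : peval F 0 = 1 -> 0 <= eta ->
  (forall z, bidisk_edge z -> 2^-1 <= complex.Re (peval F z) ->
     cnorm (peval p z) <= eta) ->
  cnorm (peval p 0) <= eta.
Proof.
move=> F0 eta0 H.
pose pt (a b : C) : 'rV[C]_2 := \row_k (if k == ord0 then a else b).
have pt0 : pt 0 0 = 0 by apply/rowP => k; rewrite !mxE if_same.
rewrite -pt0; apply: (polyfun_hull (peval_polyfun F) (peval_polyfun p)) => //.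
  by rewrite -/(pt 0 0) pt0.
move=> a b a1 b1 ab; apply: H; split; first by move=> i; rewrite mxE; case: ifP.
by case: ab => e; [exists ord0 | exists ord_max]; rewrite mxE.
Qed.

Lemma bidisk_edge_top_boundary : bidisk_edge `<=` top_boundary (closed_bidisk R).
Proof.
move=> z [zD [i zi]]; split; first exact: subset_closure.
move=> /(@nbhs_ballP _ _ z) [e /= e0 H].
have eE : e = (complex.Re e)%:C%C by rewrite RRe_real ?gtr0_real.
rewrite eE in e0 H; set r := complex.Re e in e0 H.
have r0 : 0 < r by rewrite -ltcR.
(* Pushed outwards by less than [r]: still in the ball, but its coordinate [i] has modulus 1 + r /
   2. *)
pose w : 'rV[C]_2 := (1 + r / 2)%:C%C *: z.
have /(_ i) : closed_bidisk R w.
  apply: H; split => // j k; rewrite -ball_normE /= ord1 mxE normcE ltcR.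
  have -> : z ord0 k - (1 + r / 2)%:C%C * z ord0 k = - (r / 2)%:C%C * z ord0 k.
    by rewrite rmorphD rmorph1; ring.
  have r2 : 0 < r / 2 by lra.
  rewrite cnormM cnormN cnormC gtr0_norm //; have := zD k; nra.
rewrite mxE cnormM zi cnormC ger0_norm; lra.
Qed.

Lemma closed_bidisk_edge : closed bidisk_edge.
Proof.
have -> : bidisk_edge = closed_bidisk R `&`
   ([set z | cnorm (z ord0 ord0) = 1] `|` [set z | cnorm (z ord0 ord_max) = 1]).
  apply/seteqP; split=> z [zD].
    move=> [i zi]; split=> //; case: (ltnP i 1) => i1; [left|right] => /=.
      by have <- : i = ord0 by apply/val_inj; case: i i1 {zi} => [[]].
    by have <- : i = ord_max by apply/val_inj; case: i i1 {zi} => [[|[]]].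
  by case=> zi; split=> //; [exists ord0 | exists ord_max].
have cl (i : 'I_2) (A : set R) : closed A ->
    closed [set z : 'rV[C]_2 | A (cnorm (z ord0 i))].
  move=> Acl.
  have /continuous_closedP : continuous (fun z : 'rV[C]_2 => cnorm (z ord0 i)).
    move=> z.
    apply: (@continuous_comp _ _ _ (fun z : 'rV[C]_2 => z ord0 i) (@Normc.normc R)).
      exact: coord_continuous.
    exact: cnorm_continuous.
  by move=> /(_ _ Acl).
apply: closedI; last first.
  exact: closedU (cl ord0 _ (@closed_eq _ 1)) (cl ord_max _ (@closed_eq _ 1)).
have -> : closed_bidisk R =
    \bigcap_(i in [set: 'I_2]) [set z : 'rV[C]_2 | cnorm (z ord0 i) <= 1].
  by apply/seteqP; split => z zD i; [move=> _; exact: zD | exact: (zD i I)].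
by apply: closed_bigI => i _; exact: (cl i _ (@closed_le _ 1)).
Qed.

End Bidisk.

(** * Uniform algebras *)

Section UniformNorm.
Variables (R : realType) (T : Type).
Local Notation C := R[i].
Implicit Types (K : set T) (f : T -> C).

(** [0 <= M] covers the empty [K], for which [sup] is 0. *)
Lemma unorm_le K f (M : R) : 0 <= M -> (forall x, K x -> cnorm (f x) <= M) ->
  unorm K f <= M.
Proof.
move=> M0 H; have [->|K0] := eqVneq K set0; first by rewrite /unorm image_set0 sup0.
apply: ge_sup; last by move=> _ [x Kx <-]; apply: H.
by have /set0P [x Kx] := K0; exists (cnorm (f x)), x.
Qed.

(** Some bound [M] must be given, since [sup] is 0 on unbounded sets. *)
Lemma le_unorm K f (M : R) x : (forall y, K y -> cnorm (f y) <= M) -> K x ->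
  cnorm (f x) <= unorm K f.
Proof.
move=> H Kx; apply: ub_le_sup; last by exists x.
by exists M => _ [y Ky <-]; apply: H.
Qed.

Lemma unorm_ge0 K f : 0 <= unorm K f.
Proof.
rewrite /unorm; have [hs|] := pselect (has_sup [set cnorm (f x) | x in K]).
  have [[r [x Kx xr]] hub] := hs; apply: le_trans (ub_le_sup hub _); last first.
    by exists x.
  exact: cnorm_ge0.
by move=> /sup_out ->.
Qed.

End UniformNorm.

Section UniformAlgebraTheory.
Variables (R : realType) (X : topologicalType).
Local Notation C := R[i].
Implicit Types (A B : set (X -> C)) (f g : X -> C) (K G E V : set X).

Lemma uniform_closureP B f : uniform_closure B f <->
  continuous f /\ forall e : R, 0 < e ->
    exists2 g, B g & forall x, cnorm (f x - g x) < e.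
Proof.
split=> -[cf H]; split=> //.
  move=> e e0.
  have [|g [Bg gf]] := H [set g | forall x, cnorm (f x - g x) < e].
    apply/uniform_nbhs.
    exists [set xy : C * C | ball xy.1 e%:C%C xy.2]; split.
      rewrite -entourage_ballE; exists e%:C%C => //=; by rewrite ltcR.
    move=> g /= gf x; have := gf x I.
    by rewrite -ball_normE /= normcE ltcR.
  by exists g.
move=> P /uniform_nbhs [E [+ EP]]; rewrite -entourage_ballE => -[e /= e0 eE].
have ee : e = (complex.Re e)%:C%C by rewrite RRe_real ?gtr0_real.
have [|g Bg gf] := H (complex.Re e); first by rewrite -ltcR -ee.
exists g; split=> //; apply: EP => x _ /=; apply: eE => /=.
by rewrite -ball_normE /= ee normcE ltcR.
Qed.

Lemma contfun_norm f : continuous f -> continuous (fun x => cnorm (f x)).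
Proof.
move=> cf x; apply: (@continuous_comp _ _ _ f (@Normc.normc R)); first exact: cf.
exact: cnorm_continuous.
Qed.

Lemma closed_norm_le f (a : R) : continuous f -> closed [set x | cnorm (f x) <= a].
Proof.
by move=> /contfun_norm /continuous_closedP /(_ _ (@closed_le _ a)).
Qed.

Lemma closed_norm_ge f (a : R) : continuous f -> closed [set x | a <= cnorm (f x)].
Proof.
by move=> /contfun_norm /continuous_closedP /(_ _ (@closed_ge _ a)).
Qed.

Lemma open_norm_lt f (a : R) : continuous f -> open [set x | cnorm (f x) < a].
Proof.
by move=> /contfun_norm /continuousP /(_ _ (@open_lt _ a)).
Qed.

Lemma open_norm_gt f (a : R) : continuous f -> open [set x | a < cnorm (f x)].
Proof.
by move=> /contfun_norm /continuousP /(_ _ (@open_gt _ a)).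
Qed.

Lemma unorm_attained K f : K !=set0 -> compact K -> continuous f ->
  exists2 x, K x & cnorm (f x) = unorm K f /\
    forall y, K y -> cnorm (f y) <= unorm K f.
Proof.
move=> K0 cK cf.
have [|c Kc H] := @compact_EVT_max X R (fun x => cnorm (f x)) K K0 cK.
  by apply: continuous_subspaceT; exact: contfun_norm.
rewrite inE in Kc.
have H' y : K y -> cnorm (f y) <= cnorm (f c) by move=> Ky; apply: H; rewrite inE.
have E : cnorm (f c) = unorm K f.
  by apply/le_anti; rewrite (le_unorm H' Kc) unorm_le ?cnorm_ge0.
by exists c => //; split=> // y /H'; rewrite E.
Qed.

Section Theory.
Variable A : set (X -> C).
Hypothesis uA : uniform_algebra A.

Lemma ualg_compact : compact [set: X]. Proof. by case: uA => -[]. Qed.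
Lemma ualg_nonempty : [set: X] !=set0. Proof. by case: uA => -[]. Qed.
Lemma ualg_cont f : A f -> continuous f. Proof. by case: uA => _ H *; apply: H. Qed.
Lemma ualg1 : A 1. Proof. by case: uA => _ _ []. Qed.
Lemma ualgM f g : A f -> A g -> A (f * g).
Proof. by case: uA => _ _ [_ _ H] *; apply: H. Qed.
Lemma ualgL c f g : A f -> A g -> A (c *: f + g).
Proof. by case: uA => _ _ [_ H _] *; apply: H. Qed.
Lemma ualgB f g : A f -> A g -> A (f - g).
Proof.
move=> Af Ag; have -> : f - g = (-1) *: g + f by rewrite scaleN1r addrC.
exact: ualgL.
Qed.
Lemma ualg0 : A 0.
Proof. by rewrite -(subrr 1); apply: ualgB; apply: ualg1. Qed.
Lemma ualgZ c f : A f -> A (c *: f).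
Proof. by move=> Af; rewrite -[c *: f]addr0; apply: ualgL => //; apply: ualg0. Qed.
Lemma ualgD f g : A f -> A g -> A (f + g).
Proof. by move=> Af Ag; rewrite -[f]scale1r; apply: ualgL. Qed.
Lemma ualgX f n : A f -> A (f ^+ n).
Proof.
by move=> Af; elim: n => [|n IH]; rewrite ?expr0 ?exprS; [exact: ualg1|exact: ualgM].
Qed.
Lemma ualg_closed : uniform_closure A `<=` A. Proof. by case: uA. Qed.

Lemma fexpE f n x : (f ^+ n) x = f x ^+ n.
Proof. by elim: n => [|n IH]; rewrite ?expr0 // !exprS -IH. Qed.

(** The pointwise inverse exists since |1 - f| >= 1 - r; the partial geometric sums converge to it
    uniformly, so it lies in [A]. *)
Lemma ualg_neumann f (r : R) : A f -> r < 1 -> (forall x, cnorm (f x) <= r) ->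
  exists2 g, A g & (1 - f) * g = 1.
Proof.
move=> Af r1 fr; have [x0 _] := ualg_nonempty.
have r0 : 0 <= r := le_trans (cnorm_ge0 _) (fr x0).
have low x : 1 - r <= cnorm (1 - f x).
  have := le_normcD (1 - f x) (f x); rewrite subrK cnorm1; have := fr x; lra.
have nz x : 1 - f x != 0.
  by rewrite -cnorm_eq0 gt_eqF // (lt_le_trans _ (low x)) // subr_gt0.
pose g x := (1 - f x)^-1.
have Eg : (1 - f) * g = 1 by apply/funext => x; exact: (mulfV (nz x)).
exists g => //; apply: ualg_closed; apply/uniform_closureP; split.
  have c1f : continuous (fun x => 1 - f x).
    have := ualgB ualg1 Af; exact: ualg_cont.
  by move=> x; apply: cvgV; [exact: nz | exact: c1f].
move=> e e0.
have [|n Hn] := @geometric_small R r (1 - r)^-1 e _ e0; first by rewrite r0.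
pose S := \sum_(i < n) f ^+ i.
have AS : A S.
  by apply: (big_ind A); [exact: ualg0 | exact: ualgD | move=> i _; exact: ualgX].
exists S => // x; apply: le_lt_trans Hn.
have E : g x - S x = f x ^+ n * (1 - f x)^-1.
  have : ((1 - f) * S) x = (1 - f ^+ n) x.
    by rewrite -[1 - f]opprB mulNr -subrX1 opprB.
  have -> : (1 - f ^+ n) x = 1 - f x ^+ n by rewrite -fexpE.
  have -> : ((1 - f) * S) x = (1 - f x) * S x by [].
  move=> E; apply: (mulfI (nz x)).
  by rewrite mulrBr E /g mulrCA !mulfV // mulr1 opprB addrCA subrr addr0.
rewrite E cnormM Normc.normcV cnormX mulrC ler_pM ?invr_ge0 ?exprn_ge0 ?cnorm_ge0 //.
  by rewrite lef_pV2 ?posrE ?(lt_le_trans _ (low x)) // subr_gt0.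
by rewrite lerXn2r ?nnegrE ?cnorm_ge0.
Qed.

End Theory.
End UniformAlgebraTheory.

(** * Existence of the Shilov boundary *)

Section Shilov.
Variables (R : realType) (X : topologicalType) (A : set (X -> R[i])).
Local Notation C := R[i].
Implicit Types (f g : X -> C) (K G E V : set X).
Hypothesis uA : uniform_algebra A.

Let Acont f : A f -> continuous f. Proof. exact: ualg_cont. Qed.

Lemma closed_compact E : closed E -> compact E.
Proof. by move=> cE; apply: subclosed_compact (ualg_compact uA) _. Qed.

Lemma unorm_setT f : A f -> forall x, cnorm (f x) <= unorm [set: X] f.
Proof.
move=> Af x; have [y _ [_ H]] := unorm_attained (ualg_nonempty uA)
  (ualg_compact uA) (Acont Af).
exact: H.
Qed.

Lemma unorm1 E : E !=set0 -> unorm E (1 : X -> C) = 1.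
Proof.
move=> [x Ex]; apply/le_anti/andP; split.
  by apply: unorm_le => // y _; rewrite cnorm1.
have -> : 1 = cnorm ((1 : X -> C) x) by rewrite cnorm1.
by apply: (@le_unorm _ _ _ _ 1) => // y _; rewrite cnorm1.
Qed.

(** The function 1 already forces [E] to be non-empty, as the norm over the empty set is 0. *)
Lemma closed_boundaryP E : closed_boundary A E <->
  closed E /\ forall f, A f -> unorm [set: X] f <= unorm E f.
Proof.
split=> [[_ cE H]|[cE H]]; first by split=> // f Af; rewrite H.
split=> //.
  apply/set0P/eqP => E0; have := H 1 (ualg1 uA).
  by rewrite E0 (unorm1 (ualg_nonempty uA)) /unorm image_set0 sup0 ler10.
move=> f Af; apply/le_anti; rewrite H // andbT.
apply: unorm_le; first exact: unorm_ge0.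
by move=> x _; exact: unorm_setT.
Qed.

Lemma closed_boundary_attains E f : closed_boundary A E -> A f ->
  exists2 x, E x & cnorm (f x) = unorm [set: X] f.
Proof.
move=> [E0 cE H] Af.
have [x Ex [xE _]] := unorm_attained E0 (closed_compact cE) (Acont Af).
by exists x => //; rewrite xE H.
Qed.

(** Quantifying over all closed boundaries makes finite unions of removable sets removable. *)
Definition removable V :=
  open V /\ forall E, closed_boundary A E -> closed_boundary A (E `\` V).

(* If the claim fails for E and f, then (f / |f|) ^ N u is less than 1 in modulus
   on E for all u in l when N is large, hence everywhere; so f attains its norm
   only in the removed set, which E' does not meet. *)
Lemma basic_removable (l : seq (X -> C)) E' :
  (forall u, List.In u l -> A u) -> closed_boundary A E' ->
  (forall x, E' x -> ~ forall u, List.In u l -> cnorm (u x) < 1) ->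
  removable [set x | forall u, List.In u l -> cnorm (u x) < 1].
Proof.
set V := [set x | _]; move=> lA bE' E'V.
have oV : open V.
  rewrite /V; elim: l lA {E'V V} => [_|u l IH lA].
    suff -> : [set x : X | forall u : X -> C, List.In u [::] -> cnorm (u x) < 1] = setT.
      exact: openT.
    by apply/seteqP; split=> // x _ u [].

  have -> : [set x | forall v, List.In v (u :: l) -> cnorm (v x) < 1] =
    [set x | cnorm (u x) < 1] `&` [set x | forall v, List.In v l -> cnorm (v x) < 1].
    apply/seteqP; split=> [x H|x [ux H] v [<-|vl]] //; last exact: H.
    by split=> [|v vl]; apply: H; [left | right].
  apply: openI; last by apply: IH => v vl; apply: lA; right.
  by apply: open_norm_lt; apply: Acont; apply: lA; left.
split=> // E bE; have [E0 cE HE] := bE.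
have cEV : closed (E `\` V) by rewrite setDE; apply: closedI => //; exact: open_closedC.
apply/closed_boundaryP; split=> // f Af; rewrite leNgt; apply/negP => lt.
set m := unorm [set: X] f in lt; set k := unorm (E `\` V) f in lt.
have k0 : 0 <= k := unorm_ge0 _ _.
have m0 : 0 < m by apply: le_lt_trans lt.
have kf x : E x -> ~ V x -> cnorm (f x) <= k.
  move=> Ex Vx; apply: (@le_unorm _ _ _ _ m) => // y _; exact: unorm_setT.
have [M M0 HM] : exists2 M : R, 0 <= M &
    forall u, List.In u l -> forall x, cnorm (u x) <= M.
  elim: l lA {V E'V oV cEV lt k k0 kf} => [_|u l IH lA]; first by exists 0.
  have [M M0 HM] := IH (fun v vl => lA v (or_intror vl)).
  exists (Num.max M (unorm setT u)); first by rewrite le_max M0.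
  move=> v [<-|vl] x; rewrite le_max; last by rewrite (HM v vl).
  by rewrite (unorm_setT (lA u (or_introl erefl))) orbT.
have [|N HN] := @geometric_small R (k / m) M 1 _ ltr01.
  by rewrite divr_ge0 ?(ltW m0) //= ltr_pdivrMr // mul1r.
pose h := (m^-1%:C%C *: f) ^+ N.
have Ah : A h by apply: ualgX => //; apply: ualgZ.
have nh x : cnorm (h x) = (cnorm (f x) / m) ^+ N.
  rewrite /h fexpE cnormX; congr (_ ^+ N).
  have -> : (m^-1%:C%C *: f) x = m^-1%:C%C * f x by [].
  by rewrite cnormM cnormC ger0_norm ?invr_ge0 ?ltW // mulrC.
have fm1 x : 0 <= cnorm (f x) / m <= 1.
  rewrite divr_ge0 ?cnorm_ge0 ?(ltW m0) //= ler_pdivrMr // mul1r; exact: unorm_setT.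
have h1 x : cnorm (h x) <= 1.
  by rewrite nh exprn_ile1 //; have /andP[] := fm1 x.
have hu u : List.In u l -> forall x, cnorm (h x * u x) < 1.
  move=> ul x; have Ahu : A (h * u) by apply: ualgM => //; apply: lA.
  apply: le_lt_trans (unorm_setT Ahu x) _.
  have [y Ey <-] := closed_boundary_attains bE Ahu.
  have -> : (h * u) y = h y * u y by [].
  have [Vy|nVy] := pselect (V y).
    apply: le_lt_trans (cnormM_le (h1 y) (lexx _)) _.
    by rewrite mul1r; apply: Vy.
  apply: le_lt_trans HN; rewrite cnormM mulrC; apply: ler_pM; rewrite ?cnorm_ge0 //.
    exact: HM.
  have /andP[f0 _] := fm1 y.
  by rewrite nh lerXn2r ?nnegrE ?(divr_ge0 k0 (ltW m0)) ?f0 // ler_pM2r ?invr_gt0 // kf.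
have [x E'x xm] := closed_boundary_attains bE' Af.
apply: (E'V x E'x) => u ul; have := hu u ul x.
by rewrite cnormM nh xm -/m divff ?gt_eqF // expr1n mul1r.
Qed.

(** Compactness of [E] gives a neighbourhood of [x], defined by finitely many functions of [A]
    vanishing at [x], that misses [E]. Otherwise the traces on [E] of such neighbourhoods would have
    a cluster point y in [E], which [A] separates from [x]. *)
Lemma notin_boundary_removable E x : closed_boundary A E -> ~ E x ->
  exists2 V, removable V & V x.
Proof.
move=> bE nEx; have [E0 cE _] := bE.
pose good (l : seq (X -> C)) := forall u, List.In u l -> A u /\ u x = 0.
suff [l gl H] : exists2 l, good l &
    forall y, E y -> ~ forall u, List.In u l -> cnorm (u y) <= 1.
  exists [set y | forall u, List.In u l -> cnorm (u y) < 1]; last first.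
    by move=> u /gl [_ ->]; rewrite cnorm0.
  apply: (basic_removable _ bE) => [u /gl []//|y /H Hy h].
  by apply: Hy => u /h /ltW.
apply: contrapT => none.
pose F := filter_from good
  (fun l => E `&` [set y | forall u, List.In u l -> cnorm (u y) <= 1]).
have FF : ProperFilter F.
  apply: filter_from_proper.
    apply: filter_from_filter; first by exists [::].
    move=> l l' gl gl'; exists (l ++ l').
      by move=> u /(@List.in_app_or _ l l' u) [ul|ul]; [exact: gl | exact: gl'].
    move=> y [Ey H]; split; split=> // u ul; apply: H; apply: List.in_or_app;
      by [left | right].
  move=> l gl; apply: contrapT => emp; apply: none; exists l => // y Ey H.
  by apply: emp; exists y.
have FE : F E by exists [::] => // y [].
have [y [Ey clu]] := closed_compact cE FF FE.
have [f Af fxy] : exists2 f, A f & f x <> f y.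
  by case: uA => _ _ _ _; apply=> xy; apply: nEx; rewrite xy.
have d0 : f y - f x != 0 by rewrite subr_eq0 eq_sym; apply/eqP.
(* Normalized to vanish at [x] and to equal 2 > 1 at [y]. *)
pose u := (2 / (f y - f x)) *: (f - (f x) *: (1 : X -> C)).
have Au : A u by apply: ualgZ => //; apply: ualgB => //; apply: ualgZ => //; apply: ualg1.
have uE z : u z = 2 / (f y - f x) * (f z - f x * 1) by [].
have [||z [[Ez Hz] uz]] := clu
  (E `&` [set y | forall v, List.In v [:: u] -> cnorm (v y) <= 1])
  [set z | 1 < cnorm (u z)].
- by exists [:: u] => // v [<-|//]; split=> //; rewrite uE mulr1 subrr mulr0.
- apply: open_nbhs_nbhs; split; first by apply: open_norm_gt; exact: Acont.
  rewrite /= uE mulr1 divfK //.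
  have -> : (2 : C) = (2 : R)%:C%C by rewrite rmorph_nat.
  by rewrite cnormC ger0_norm // ltr1n.
have := Hz u (or_introl erefl); move: uz => /= uz.
by rewrite leNgt uz.
Qed.

(** If f were smaller on the intersection G, no finite union of removable sets would cover the
    compact set where f attains its norm. A cluster point of the remainders lies outside G, hence
    outside some closed boundary, hence in a removable set: a contradiction. *)
Lemma shilov_boundary_exists :
  is_shilov_boundary A (\bigcap_(E in closed_boundary A) E).
Proof.
split; last by move=> E bE x; apply.
set G := \bigcap_(E in _) E.
have cG : closed G by apply: closed_bigI => E [].
have bT : closed_boundary A setT.
  by apply/closed_boundaryP; split=> //; exact: closedT.
apply/closed_boundaryP; split=> // f Af; rewrite leNgt; apply/negP => lt.
set m := unorm [set: X] f in lt.
pose K := [set x | m <= cnorm (f x)].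
have cK : compact K.
  by apply: closed_compact; apply: closed_norm_ge; exact: Acont.
pose F := filter_from removable (fun V => K `\` V).
have r0 : removable set0 by split=> [|E]; [exact: open0 | rewrite setD0].
have FF : ProperFilter F.
  apply: filter_from_proper.
    apply: filter_from_filter; first by exists set0.
    move=> V W [oV rV] [oW rW]; exists (V `|` W).
      by split=> [|E bE]; [exact: openU | rewrite -setDDl; apply: rW; exact: rV].
    by move=> x [Kx nVW]; split; split=> // ?; apply: nVW; [left|right].
  move=> V [_ rV]; have [x [_ nVx] xm] := closed_boundary_attains (rV _ bT) Af.
  by exists x; split=> //; rewrite /K /= xm.
have FK : F K by exists set0 => // x [].
have [x [Kx clu]] := cK F FF FK.
have [E bE nEx] : exists2 E, closed_boundary A E & ~ E x.
  apply: contrapT => none; suff Gx : G x.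
    move: lt; apply/negP; rewrite -leNgt; apply: le_trans Kx _.
    by apply: (@le_unorm _ _ _ _ m) => // y _; exact: unorm_setT.
  by move=> E bE; apply: contrapT => nEx; apply: none; exists E.
have [V rV Vx] := notin_boundary_removable bE nEx.
have [||y [[_ nVy] Vy]] := clu (K `\` V) V => //; first by exists V.
by apply: open_nbhs_nbhs; split=> //; case: rV.
Qed.

End Shilov.

(** * The algebras P(K) *)

Section Subtype.
Variables (T : topologicalType) (K : set T).

Lemma compact_set_type : compact K -> compact [set: set_type K].
Proof.
move=> cK F FF _.
have FK : (set_val @ F) K by apply: (@filterE _ F) => x; exact: set_valP.
have [p [Kp clp]] := cK _ (fmap_proper_filter (set_val : set_type K -> T) FF) FK.
exists (exist _ p (mem_set Kp)); split=> // S B FS [_ /= [[W oW <-] Wp WB]].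
have [||_ [[x Sx <-] Wx]] := clp (set_val @` S) W.
- by apply: (@filterS _ F _ S _ _ FS) => x Sx; exists x.
- exact: open_nbhs_nbhs.
by exists x; split=> //; apply: WB.
Qed.

Lemma set_val_continuous : continuous (set_val : set_type K -> T).
Proof. exact: initial_continuous. Qed.

End Subtype.

Section Generation.
Variables (R : realType) (X : topologicalType).
Local Notation C := R[i].
Implicit Types (B : set (X -> C)) (f g : X -> C).

Lemma hausdorff_separating :
  (forall x y : X, x <> y -> exists2 f : X -> C, continuous f & f x <> f y) ->
  hausdorff_space X.
Proof.
move=> sep p q clu; apply: contrapT => /sep [f cf fpq].
pose d := cnorm (f p - f q).
have d0 : 0 < d.
  by rewrite lt_neqAle cnorm_ge0 eq_sym cnorm_eq0 subr_eq0 andbT; apply/eqP.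
have nb (y : X) : nbhs y [set z | cnorm (f y - f z) < d / 2].
  have : nbhs (f y) [set u | cnorm (f y - u) < d / 2].
    by apply/nbhs_cnormP; exists (d / 2) => //; rewrite divr_gt0.
  exact: cf.
have [z [/= zp zq]] := clu _ _ (nb p) (nb q).
have : d <= cnorm (f p - f z) + cnorm (f q - f z).
  rewrite /d; have -> : f p - f q = (f p - f z) - (f q - f z) by ring.
  exact: cnormB_le.
lra.
Qed.

Lemma uniform_closure_sub B : B `<=` contfun (R := R) (X := X) ->
  B `<=` uniform_closure B.
Proof.
move=> Bc f Bf; apply/uniform_closureP; split; first exact: Bc.
by move=> e e0; exists f => // x; rewrite subrr cnorm0.
Qed.

Lemma uniform_closure_algebra B : [set: X] !=set0 -> compact [set: X] ->
  B `<=` contfun (R := R) (X := X) -> B 1 ->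
  (forall (c : C) f g, B f -> B g -> B (c *: f + g)) ->
  (forall f g, B f -> B g -> B (f * g)) ->
  (forall x y, x <> y -> exists2 f, B f & f x <> f y) ->
  uniform_algebra (uniform_closure B).
Proof.
move=> X0 cX Bc B1 BL BM Bsep; have BU := uniform_closure_sub Bc.
have bound f : continuous f -> exists2 M : R, 0 < M & forall x, cnorm (f x) <= M.
  move=> cf; have [y _ [_ H]] := unorm_attained X0 cX cf.
  exists (unorm [set: X] f + 1); first by rewrite ltr_wpDl ?unorm_ge0.
  by move=> x; apply: le_trans (H x I) _; rewrite lerDl.
split.
- split=> //; apply: hausdorff_separating => x y /Bsep [f Bf fxy].
  by exists f => //; apply: Bc.
- by move=> f /uniform_closureP [].
- split; first exact: BU.
  + move=> c f g /uniform_closureP [cf Hf] /uniform_closureP [cg Hg].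
    apply/uniform_closureP; split.
      exact: ccontinuousD (ccontinuousM (fun=> cvg_cst c) cf) cg.
    move=> e e0; pose k := cnorm c + 1.
    have k0 : 0 < k by rewrite ltr_wpDl ?cnorm_ge0.
    have [|f' Bf' ff'] := Hf (e / 2 / k); first by rewrite !divr_gt0.
    have [|g' Bg' gg'] := Hg (e / 2); first by rewrite divr_gt0.
    exists (c *: f' + g'); first exact: BL.
    move=> x.
    have -> : (c *: f + g) x - (c *: f' + g') x
            = c * (f x - f' x) + (g x - g' x).
      have -> : (c *: f + g) x - (c *: f' + g') x =
                c * f x + g x - (c * f' x + g' x) by [].
      by ring.
    have h1 : cnorm c * cnorm (f x - f' x) <= e / 2.
      apply: (@le_trans _ _ (k * (e / 2 / k))).
        by apply: ler_pM; rewrite ?cnorm_ge0 ?lerDl // ltW.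
      by rewrite mulrC divfK ?gt_eqF.
    apply: le_lt_trans (le_normcD _ _) _; rewrite cnormM.
    have := gg' x; lra.
  + move=> f g /uniform_closureP [cf Hf] /uniform_closureP [cg Hg].
    apply/uniform_closureP; split; first exact: ccontinuousM.
    move=> e e0; have [M M0 fM] := bound f cf.
    (* [g'] comes before [f'], whose tolerance depends on a bound of [g']. *)
    have [g' Bg' gg'] := Hg (e / 2 / M) (divr_gt0 (divr_gt0 e0 (ltr0n _ 2)) M0).
    have [M' M'0 gM'] := bound g' (Bc _ Bg').
    have [f' Bf' ff'] := Hf (e / 2 / M') (divr_gt0 (divr_gt0 e0 (ltr0n _ 2)) M'0).
    exists (f' * g'); first exact: BM.
    move=> x.
    have -> : (f * g) x - (f' * g') x = f x * (g x - g' x) + (f x - f' x) * g' x.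
      have -> : (f * g) x - (f' * g') x = f x * g x - f' x * g' x by [].
      by ring.
    apply: le_lt_trans (le_normcD _ _) _; rewrite !cnormM.
    have h1 : cnorm (f x) * cnorm (g x - g' x) <= e / 2.
      apply: (@le_trans _ _ (M * (e / 2 / M))).
        by apply: ler_pM; rewrite ?cnorm_ge0 // ltW.
      by rewrite mulrC divfK ?gt_eqF.
    have h2 : cnorm (f x - f' x) * cnorm (g' x) < e / 2.
      apply: (@le_lt_trans _ _ (cnorm (f x - f' x) * M')).
        by rewrite ler_wpM2l ?cnorm_ge0.
      by rewrite -ltr_pdivlMr.
    lra.
- move=> f /uniform_closureP [cf Hf]; apply/uniform_closureP; split=> // e e0.
  have e20 : 0 < e / 2 by lra.
  have [g /uniform_closureP [_ Hg] fg] := Hf _ e20.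
  have [h Bh gh] := Hg _ e20; exists h => // x.
  have -> : f x - h x = (f x - g x) + (g x - h x) by ring.
  by apply: le_lt_trans (le_normcD _ _) _; have := fg x; have := gh x; lra.
by move=> x y /Bsep [f Bf fxy]; exists f => //; apply: BU.
Qed.

End Generation.

Section Palg.
Variables (R : realType) (n : nat) (K : set 'rV[R[i]]_n).
Local Notation C := R[i].
Implicit Types (p q : mpoly.mpoly n C).
Hypotheses (K0 : K !=set0) (cK : compact K).

Definition polyres p : set_type K -> C := fun z => peval p (set_val z).

Lemma polyres_continuous p : continuous (polyres p).
Proof.
move=> z; apply: (@continuous_comp _ _ _ (set_val : set_type K -> _) (peval p)).
  exact: set_val_continuous.
exact: peval_continuous.
Qed.

Lemma Palg_polyres p : Palg K (polyres p).
Proof.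
apply: uniform_closure_sub; last by exists p.
by move=> _ [q _ <-]; exact: polyres_continuous.
Qed.

Lemma Palg_approx f (e : R) : Palg K f -> 0 < e ->
  exists p, forall z, cnorm (f z - polyres p z) < e.
Proof.
by move=> /uniform_closureP [_ H] /H [_ [p _ <-] Hp]; exists p.
Qed.

Lemma Palg_uniform_algebra : uniform_algebra (Palg K).
Proof.
apply: uniform_closure_algebra.
- by have [z Kz] := K0; exists (exist _ z (mem_set Kz)).
- exact: compact_set_type.
- by move=> _ [p _ <-]; exact: polyres_continuous.
- by exists 1 => //; apply/funext => z; rewrite peval1.
- move=> c _ _ [p _ <-] [q _ <-]; exists (c *: p + q) => //; apply/funext => z.
  by rewrite pevalD pevalZ.
- move=> _ _ [p _ <-] [q _ <-]; exists (p * q) => //; apply/funext => z.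
  by rewrite pevalM.
move=> x y xy.
have [i xyi] : exists i, set_val x ord0 i <> set_val y ord0 i.
  apply: contrapT => none; apply: xy; apply/val_inj/rowP => i.
  by apply: contrapT => xyi; apply: none; exists i.
exists (polyres (mpoly.mpolyX C (mpoly.mnm1 i))); first by eexists.
by rewrite /polyres !peval_var.
Qed.

(** The inverse of p is e / (1 - q), by the Neumann series of q. *)
Lemma Palg_invertible p q e (r : R) : r < 1 ->
  (forall z, K z -> peval p z * peval e z = 1 - peval q z) ->
  (forall z, K z -> cnorm (peval q z) <= r) ->
  invertibles (Palg K) (polyres p).
Proof.
move=> r1 pe qr; split; first exact: Palg_polyres.
have uA := Palg_uniform_algebra.
have KK (z : set_type K) : K (set_val z) by exact: set_valP.
have [k Ak Ek] := ualg_neumann uA (Palg_polyres q) r1 (fun z => qr _ (KK z)).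
exists (polyres e * k); first exact: (ualgM uA (Palg_polyres e) Ak).
rewrite -Ek mulrA; congr (_ * _); apply/funext => z.
exact: (pe _ (KK z)).
Qed.

(** The images of the coordinates under a character form a point x. Characters are contractive, so x
    lies in the hull, hence in [K]; evaluation at x agrees with the character on polynomials, and by
    density everywhere. *)
Lemma Palg_natural : poly_hull K `<=` K -> natural_on (Palg K).
Proof.
move=> hullK phi [phiL phiM [f0 Af0 phif0]].
have uA := Palg_uniform_algebra; have A1 := ualg1 uA.
have phi1 : phi 1 = 1.
  apply/(mulIf (introN eqP phif0)).
  by rewrite -phiM // mul1r mul1r.
have phi0 : phi 0 = 0.
  have := phiL (-1) 0 0 (ualg0 uA) (ualg0 uA).
  by rewrite scaler0 addr0 mulN1r addNr.
have phiZ c f : Palg K f -> phi (c *: f) = c * phi f.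
  by move=> Af; rewrite -[c *: f]addr0 phiL ?phi0 ?addr0 //; exact: ualg0.
have phiD f g : Palg K f -> Palg K g -> phi (f + g) = phi f + phi g.
  by move=> Af Ag; rewrite -[f]scale1r phiL // mul1r scale1r.
(* Continuity of [phi] is not assumed: if |phi f| > M, then 1 - f / phi(f) is invertible although
   [phi] kills it. *)
have phi_le f (M : R) : Palg K f -> (forall z, cnorm (f z) <= M) ->
    cnorm (phi f) <= M.
  move=> Af fM; rewrite leNgt; apply/negP => lt.
  have [z0 _] := ualg_nonempty uA.
  have M0 : 0 <= M := le_trans (cnorm_ge0 _) (fM z0).
  have p0 : 0 < cnorm (phi f) := le_lt_trans M0 lt.
  have pf : phi f != 0 by rewrite -cnorm_eq0 gt_eqF.
  have r1 : M / cnorm (phi f) < 1 by rewrite ltr_pdivrMr // mul1r.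
  have Ag := ualgZ uA (phi f)^-1 Af.
  have [|k Ak Ek] := ualg_neumann uA Ag r1.
    move=> z; have -> : ((phi f)^-1 *: f) z = (phi f)^-1 * f z by [].
    by rewrite cnormM Normc.normcV mulrC ler_wpM2r ?invr_ge0 ?cnorm_ge0.
  have : phi (1 - (phi f)^-1 *: f) * phi k = 1.
    by rewrite -phiM ?Ek //; exact: (ualgB uA).
  rewrite -scaleN1r addrC phiL // phi1 phiZ // mulVf // mulr1 addNr mul0r.
  by move=> /eqP; rewrite eq_sym oner_eq0.
pose x : 'rV[C]_n := \row_i phi (polyres (mpoly.mpolyX C (mpoly.mnm1 i))).
have phip p : phi (polyres p) = peval p x.
  pose P (h : 'rV[C]_n -> C) := Palg K (fun z => h (set_val z)) /\
    phi (fun z => h (set_val z)) = h x.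
  suff [] : P (peval p) by [].
  apply: (@peval_ind _ _ P) p => [c|i|f g [Af Ef] [Ag Eg]|f g [Af Ef] [Ag Eg]].
  - have E : (fun _ : set_type K => c) = c *: (1 : set_type K -> C).
      by apply/funext => z; rewrite -[LHS]mulr1.
    split; first by rewrite E; exact: ualgZ.
    by rewrite E phiZ // phi1 mulr1.
  - rewrite /P mxE; have E : polyres (mpoly.mpolyX C (mpoly.mnm1 i)) =
      (fun z : set_type K => set_val z ord0 i).
      by apply/funext => z; rewrite /polyres peval_var.
    by rewrite -E; split; first exact: Palg_polyres.
  - by split; [exact: (ualgD uA Af Ag) | rewrite -Ef -Eg -phiD].
  - by split; [exact: (ualgM uA Af Ag) | rewrite -Ef -Eg -phiM].
have Kx : K x.
  apply: hullK => p; rewrite -phip; apply: phi_le; first exact: Palg_polyres.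
  move=> z; have [y _ [_ H]] := unorm_attained K0 cK (@peval_continuous _ _ p).
  by apply: H; exact: set_valP.
exists (exist _ x (mem_set Kx)) => f Af; apply/eqP; rewrite -subr_eq0 -cnorm_eq0.
rewrite eq_le cnorm_ge0 andbT; apply/ler_addgt0Pr => e e0; rewrite add0r.
have e20 : 0 < e / 2 by lra.
have [p Hp] := Palg_approx Af e20.
set z := exist _ _ _.
have -> : phi f - f z = phi (f - polyres p) - (f z - polyres p z).
  have -> : phi (f - polyres p) = phi f - peval p x.
    by rewrite -scaleN1r addrC phiL ?mulN1r ?phip 1?addrC //; exact: Palg_polyres.
  have -> : polyres p z = peval p x by [].
  by ring.
have -> : e = e / 2 + e / 2 by lra.
apply: cnormB_le; last exact: ltW.
apply: phi_le; first exact: (ualgB uA Af (Palg_polyres p)).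
by move=> y; apply: ltW; exact: Hp.
Qed.

End Palg.

(** * The construction *)

Section DensePolynomials.
Variable R : realType.
Local Notation C := R[i].
Local Notation poly2 := (mpoly.mpoly 2 C).
Local Notation D := (closed_bidisk R).

(** Gaussian rational polynomials, coded by a countable type so that [unpickle] enumerates them. *)
Fixpoint gauss_poly (l : seq (mpoly.multinom 2 * (rat * rat))) : poly2 :=
  if l is (m, (a, b)) :: l'
  then Complex (ratr a) (ratr b) *: mpoly.mpolyX C m + gauss_poly l' else 0.

Lemma gauss_rational_dense (c : C) (e : R) : 0 < e ->
  exists a b : rat, cnorm (c - Complex (ratr a) (ratr b)) < e.
Proof.
case: c => x y e0; have e20 : 0 < e / 2 by lra.
have near (u : R) : exists a : rat, `|u - ratr a| < e / 2.
  have [|a] := @rat_in_itvoo R (u - e / 2) (u + e / 2); first lra.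
  rewrite in_itv /= => /andP[h1 h2]; exists a; rewrite ltr_norml; lra.
have [a ha] := near x; have [b hb] := near y; exists a, b.
have -> : Complex x y - Complex (ratr a) (ratr b) =
    (x - ratr a)%:C%C + Complex 0 1 * (y - ratr b)%:C%C.
  by apply/eqP; rewrite eq_complex /=; apply/andP; split; apply/eqP; ring.
apply: le_lt_trans (le_normcD _ _) _.
rewrite cnormM !cnormC /= expr0n expr1n add0r sqrtr1 mul1r; lra.
Qed.

Lemma cnorm_monomial (m : mpoly.multinom 2) (z : 'rV[C]_2) : D z ->
  cnorm (peval (mpoly.mpolyX C m) z) <= 1.
Proof.
move=> zD; rewrite /peval mpoly.mevalX.
apply: (big_ind (fun x : C => cnorm x <= 1)) => [|x y x1 y1|i _].
- by rewrite cnorm1.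
- by rewrite -[leRHS]mul1r cnormM_le.
by rewrite cnormX exprn_ile1 ?cnorm_ge0.
Qed.

Lemma gauss_poly_dense (p : poly2) (e : R) : 0 < e ->
  exists l, forall z, D z -> cnorm (peval p z - peval (gauss_poly l) z) < e.
Proof.
elim/mpoly.mpolyind: p e => [|c m p _ _ IH] e e0.
  by exists [::] => z _; rewrite subrr cnorm0.
have e20 : 0 < e / 2 by lra.
have [l Hl] := IH _ e20; have [a [b Hab]] := gauss_rational_dense c e20.
exists ((m, (a, b)) :: l) => z zD /=; rewrite !pevalD !pevalZ.
set u := peval _ z; set v := peval p z; set w := peval _ z; set d := Complex _ _.
have -> : c * u + v - (d * u + w) = (c - d) * u + (v - w) by ring.
apply: le_lt_trans (le_normcD _ _) _.
have h1 : cnorm ((c - d) * u) <= cnorm (c - d).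
  by rewrite -[leRHS]mulr1 cnormM_le // cnorm_monomial.
by have := Hl z zD; rewrite -/v -/w -/d in Hab *; lra.
Qed.

Lemma bidisk0 : D 0.
Proof. by move=> i; rewrite mxE cnorm0. Qed.

Lemma dense_sequence : exists f : nat -> poly2, (forall n, peval (f n) 0 != 0) /\
  forall p (e : R), 0 < e -> exists n, forall z, D z ->
    cnorm (peval p z - peval (f n) z) < e.
Proof.
pose f n : poly2 := if unpickle n is Some l then
  (if peval (gauss_poly l) 0 == 0 then 1 else gauss_poly l) else 1.
exists f; split=> [n|p e e0].
  rewrite /f; case: unpickle => [l|]; last by rewrite peval1 oner_eq0.
  by case: ifP => [_|/negbT //]; rewrite peval1 oner_eq0.
(* Excluding polynomials that vanish at 0 preserves density, since [p] can be shifted by a small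
   constant. *)
have [c ce pc] : exists2 c : C, cnorm c <= e / 4%:R & peval p 0 + c != 0.
  have [p0|p0] := eqVneq (peval p 0) 0; last first.
    by exists 0; rewrite ?cnorm0 ?addr0 //; lra.
  have e40 : 0 < e / 4%:R by lra.
  exists (e / 4%:R)%:C%C; first by rewrite cnormC gtr0_norm.
  by rewrite p0 add0r -cnorm_eq0 cnormC gtr0_norm // gt_eqF.
(* The second bound prevents the approximant from vanishing at 0, where [f] would replace it by
   1. *)
pose d := Num.min (e / 4%:R) (cnorm (peval p 0 + c)).
have d0 : 0 < d.
  rewrite lt_min; apply/andP; split; first lra.
  by rewrite lt_neqAle eq_sym cnorm_eq0 pc cnorm_ge0.
have [l Hl] := gauss_poly_dense (p + mpoly.mpolyC 2 c) d0.
have E z : peval (p + mpoly.mpolyC 2 c) z = peval p z + c by rewrite pevalD pevalC.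
have l0 : peval (gauss_poly l) 0 != 0.
  apply/eqP => l0; have := Hl 0 bidisk0.
  by rewrite E l0 subr0 lt_min ltxx andbF.
exists (pickle l) => z zD; rewrite /f pickleK (negbTE l0).
have := Hl z zD; rewrite E lt_min => /andP[h _].
set w := peval (gauss_poly l) z in h *.
have -> : peval p z - w = (peval p z + c - w) - c by ring.
have := cnormB_le (ltW h) ce; lra.
Qed.

Lemma bidisk_bound (p : poly2) : exists2 M : R, 0 <= M &
  forall z, D z -> cnorm (peval p z) <= M.
Proof.
have [_ _ [_ H]] := unorm_attained (ex_intro _ 0 bidisk0)
  (@compact_closed_bidisk R) (@peval_continuous _ _ p).
by exists (unorm D (peval p)) => //; exact: unorm_ge0.
Qed.

(** With r = 1 + M^2 and s = 1 / r, the squared modulus is at most 1 - s + (r - 1) s^2 = 1 - s^2,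
    which is at most (1 - s^2 / 2)^2. *)
Lemma cnorm_contract (z : C) (M : R) : 2^-1 <= complex.Re z -> cnorm z <= M ->
  cnorm (1 - z / (1 + M ^+ 2)%:C%C) <= 1 - (2%:R * (1 + M ^+ 2) ^+ 2)^-1.
Proof.
move=> Rz zM; set r := 1 + M ^+ 2.
have r1 : 1 <= r by rewrite lerDl sqr_ge0.
have r0 : 0 < r by lra.
set s := r^-1; have s0 : 0 < s by rewrite invr_gt0.
have s1 : s <= 1 by rewrite invf_le1.
have rs : r * s = 1 by rewrite mulfV // gt_eqF.
have -> : (2%:R * r ^+ 2)^-1 = s ^+ 2 / 2 by rewrite invfM exprVn mulrC.
have t1 : s ^+ 2 <= 1 by rewrite exprn_ile1 // ltW.
rewrite -(@ler_pXn2r _ 2) ?nnegrE ?cnorm_ge0 //; last lra.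
have zz := sqr_cnorm z.
have zM2 : complex.Re z ^+ 2 + complex.Im z ^+ 2 <= r - 1.
  rewrite -zz /r addrC addKr lerXn2r ?nnegrE ?cnorm_ge0 //.
  exact: le_trans (cnorm_ge0 _) zM.
have -> : cnorm (1 - z / r%:C%C) ^+ 2 =
    1 - 2%:R * complex.Re z * s + (complex.Re z ^+ 2 + complex.Im z ^+ 2) * s ^+ 2.
  have -> : z / r%:C%C = z * s%:C%C by rewrite /s fmorphV.
  by rewrite sqr_cnorm; case: z {Rz zM zz zM2} => x y /=; ring.
have h1 := ler_wpM2r (sqr_ge0 s) zM2.
have h2 := ler_wpM2r (ltW s0) Rz.
have h3 : (r - 1) * s ^+ 2 = s - s ^+ 2.
  by rewrite mulrBl mul1r expr2 mulrA rs mul1r.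
have h4 : 0 <= (s ^+ 2 / 2) ^+ 2 by rewrite sqr_ge0.
by rewrite sqrrB expr1n mul1r; lra.
Qed.

(** [cnorm_contract] applied to 1 - F, where Re F < 1/2, bounds q = 1 - (1 - F) / r by some s < 1,
    while q(0) = 1. Here [M ^+ 2], for a bound [M] of |1 - F|, is the M of the overview. *)
Lemma refine_step (F f : poly2) : peval F 0 = 1 -> peval f 0 != 0 ->
  exists e : poly2, peval (f * e) 0 = 1 /\ forall z, D z ->
    2^-1 <= complex.Re (peval (f * e) z) -> 2^-1 <= complex.Re (peval F z).
Proof.
move=> F0 f0.
have [M M0 HM] := bidisk_bound (1 - F); have [K K0 HK] := bidisk_bound f.
pose r := 1 + M ^+ 2; pose s := 1 - (2%:R * r ^+ 2)^-1.
have r1 : 1 <= r by rewrite lerDl sqr_ge0.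
have r2 : 1 <= r ^+ 2 by rewrite exprn_ege1.
have s01 : 0 <= s < 1.
  rewrite /s subr_ge0 gtrBl invr_gt0 mulr_gt0 ?(lt_le_trans ltr01 r2) // andbT.
  by rewrite invf_le1; lra.
have [N HN] := geometric_small (K / cnorm (peval f 0)) s01 (e := 2^-1) ltac:(lra).
pose q : poly2 := 1 - (r%:C%C)^-1 *: (1 - F).
have qE z : peval q z = 1 - (1 - peval F z) / r%:C%C.
  by rewrite pevalB peval1 pevalZ pevalB peval1 mulrC.
exists ((peval f 0)^-1 *: q ^+ N); split.
  by rewrite pevalM pevalZ pevalXn qE F0 subrr mul0r subr0 expr1n mulr1 mulfV.
move=> z zD; rewrite pevalM pevalZ pevalXn leNgt => h; rewrite leNgt.
apply: contra h => Fz; apply: le_lt_trans HN.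
apply: le_trans (ler_norm _) _; apply: le_trans (Re_le_cnorm _) _.
rewrite !cnormM Normc.normcV cnormX mulrA.
have d0 : 0 <= (cnorm (peval f 0))^-1 by rewrite invr_ge0 cnorm_ge0.
apply: ler_pM; rewrite ?exprn_ge0 ?mulr_ge0 ?cnorm_ge0 //.
  by rewrite ler_wpM2r // HK.
have /andP[s0 _] := s01.
rewrite lerXn2r ?nnegrE ?cnorm_ge0 // qE; apply: cnorm_contract.
  by rewrite raddfB /=; lra.
by have := HM z zD; rewrite pevalB peval1.
Qed.

End DensePolynomials.

Section DenseInvertibles.
Variable R : realType.
Local Notation C := R[i].
Local Notation poly2 := (mpoly.mpoly 2 C).
Local Notation D := (closed_bidisk R).

Lemma Palg_dense_invertibles (K : set 'rV[C]_2) (f : nat -> poly2) :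
  K `<=` D ->
  (forall p (e : R), 0 < e -> exists n, forall z, D z ->
    cnorm (peval p z - peval (f n) z) < e) ->
  (forall n, invertibles (Palg K) (polyres (f n))) ->
  dense_invertibles (Palg K).
Proof.
move=> KD fd finv g Ag; apply/uniform_closureP.
split; first by case/uniform_closureP: Ag.
move=> e e0; have e20 : 0 < e / 2 by lra.
have [p Hp] := Palg_approx Ag e20; have [n Hn] := fd p _ e20.
exists (polyres (f n)) => // z.
have Dz : D (set_val z) by apply: KD; exact: set_valP.
have -> : g z - polyres (f n) z = (g z - polyres p z) +
   (peval p (set_val z) - peval (f n) (set_val z)) by rewrite /polyres; ring.
apply: le_lt_trans (le_normcD _ _) _.
by have := Hp z; have := Hn _ Dz; lra.
Qed.

Lemma refinement (f : nat -> poly2) : (forall n, peval (f n) 0 != 0) ->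
  exists G e : nat -> poly2, [/\ forall n, peval (G n) 0 = 1,
    forall n, G n.+1 = f n * e n &
    forall n z, D z -> 2^-1 <= complex.Re (peval (G n.+1) z) ->
      2^-1 <= complex.Re (peval (G n) z)].
Proof.
move=> f0.
(* With the premise under the existential, the choice of [e] is total in [F] and the recursion
   carries no proofs. *)
have step n (F : poly2) : exists e : poly2, peval F 0 = 1 ->
    peval (f n * e) 0 = 1 /\ forall z, D z ->
    2^-1 <= complex.Re (peval (f n * e) z) -> 2^-1 <= complex.Re (peval F z).
  have [F0|nF0] := pselect (peval F 0 = 1); last by exists 0.
  by have [e He] := refine_step F0 (f0 n); exists e.
pose e n F := projT1 (cid (step n F)).
pose G := fix G n : poly2 := if n is m.+1 then f m * e m (G m) else 1.
have G0 n : peval (G n) 0 = 1.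
  elim: n => [|n IH]; first exact: peval1.
  by have [] := projT2 (cid (step n (G n))) IH.
exists G, (fun n => e n (G n)); split=> // n z.
by have [_] := projT2 (cid (step n (G n))) (G0 n); apply.
Qed.

End DenseInvertibles.

(** * The compact set Y and its hull at the origin *)

Section Main.
Variable R : realType.
Local Notation C := R[i].
Local Notation poly2 := (mpoly.mpoly 2 C).
Local Notation D := (closed_bidisk R).
Variable G : nat -> poly2.
Hypothesis G0 : forall n, peval (G n) 0 = 1.
Hypothesis Gdec : forall n z, D z ->
  2^-1 <= complex.Re (peval (G n.+1) z) -> 2^-1 <= complex.Re (peval (G n) z).

Definition level_edge : set 'rV[C]_2 :=
  [set z | bidisk_edge z /\ forall n, 2^-1 <= complex.Re (peval (G n) z)].

Lemma Gdec_le n m z : D z -> (n <= m)%N ->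
  2^-1 <= complex.Re (peval (G m) z) -> 2^-1 <= complex.Re (peval (G n) z).
Proof.
move=> zD; elim: m => [|m IH]; first by rewrite leqn0 => /eqP ->.
by rewrite leq_eqVlt => /orP[/eqP -> //|/IH H] /(Gdec zD).
Qed.

Lemma closed_Re_ge n : closed [set z : 'rV[C]_2 | 2^-1 <= complex.Re (peval (G n) z)].
Proof.
have /continuous_closedP :
    continuous (fun z : 'rV[C]_2 => complex.Re (peval (G n) z)).
  move=> z; apply: (@continuous_comp _ _ _ (peval (G n)) (@complex.Re R)).
    exact: peval_continuous.
  exact: Re_continuous.
by move=> /(_ _ (@closed_ge _ 2^-1)).
Qed.

Lemma compact_level_edge : compact level_edge.
Proof.
apply: (subclosed_compact _ (@compact_closed_bidisk R)); last by move=> z [[]].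
have -> : level_edge = @bidisk_edge R `&`
    \bigcap_(n in [set: nat]) [set z | 2^-1 <= complex.Re (peval (G n) z)].
  by apply/seteqP; split=> z [ez H]; split=> // n; [move=> _ |]; exact: H.
apply: closedI; first exact: closed_bidisk_edge.
by apply: closed_bigI => n _; exact: closed_Re_ge.
Qed.

(** The closed sets [S n] decrease and are non-empty by [edge_hull], so by compactness they share a
    point. With p = 1 this also yields a point of Y. *)
Lemma level_edge_large (p : poly2) (d : R) : 0 < d ->
  exists2 z, level_edge z & cnorm (peval p 0) - d <= cnorm (peval p z).
Proof.
move=> d0; set c := cnorm (peval p 0) - d.
pose S n := [set z | [/\ @bidisk_edge R z, 2^-1 <= complex.Re (peval (G n) z) &
   c <= cnorm (peval p z)]].
have cS n : closed (S n).
  have -> : S n = (@bidisk_edge R `&` [set z | 2^-1 <= complex.Re (peval (G n) z)])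
      `&` [set z | c <= cnorm (peval p z)].
    by apply/seteqP; split=> z; [case | case=> -[]].
  apply: closedI; last exact/closed_norm_ge/peval_continuous.
  by apply: closedI; [exact: closed_bidisk_edge | exact: closed_Re_ge].
have S0 n : S n !=set0.
  apply: contrapT => emp.
  have lt z : bidisk_edge z -> 2^-1 <= complex.Re (peval (G n) z) ->
      cnorm (peval p z) < c.
    by move=> ez Gz; rewrite ltNge; apply/negP => h; apply: emp; exists z.
  have [c0|c0] := leP 0 c.
    have := edge_hull (G0 n) c0 (fun z ez Gz => ltW (lt z ez Gz)).
    by rewrite /c; lra.
  (* For [c < 0], [edge_hull] does not accept [c] as a bound; but then the level set itself is empty
     and every polynomial would vanish at 0. *)
  have /(_ 1) : forall q : poly2, cnorm (peval q 0) <= 0.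
    move=> q; apply: (edge_hull (G0 n)) => // z ez /(lt z ez).
    by have := cnorm_ge0 (peval p z); lra.
  by rewrite peval1 cnorm1 ler10.
pose F := filter_from [set: nat] S.
have FF : ProperFilter F.
  apply: filter_from_proper; last by move=> n _; exact: S0.
  apply: filter_from_filter; first by exists 0%N.
  move=> n m _ _; exists (maxn n m) => // z [ez Gz pz]; have [zD _] := ez.
  by split; split=> //; apply: (Gdec_le zD) Gz; rewrite ?leq_maxl ?leq_maxr.
have [|z [_ clz]] := @compact_closed_bidisk R F FF.
  by exists 0%N => // z [[]].
have Sz n : S n z.
  by apply: cS => B Bz; apply: clz => //; exists n.
exists z; last by have [] := Sz 0%N.
by split=> [|n]; [have [] := Sz 0%N | have [] := Sz n].
Qed.

End Main.

(** * Polynomially convex hulls *)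

Section Hull.
Variables (R : realType) (n : nat) (K : set 'rV[R[i]]_n).
Local Notation C := R[i].
Implicit Types (p : mpoly.mpoly n C) (z : 'rV[C]_n).
Hypotheses (K0 : K !=set0) (cK : compact K).

Lemma cnorm_le_unorm p z : K z -> cnorm (peval p z) <= unorm K (peval p).
Proof.
move=> Kz; have [_ _ [_ H]] := unorm_attained K0 cK (@peval_continuous _ _ p).
exact: H.
Qed.

Lemma sub_poly_hull : K `<=` poly_hull K.
Proof. by move=> z Kz p; exact: cnorm_le_unorm. Qed.

Lemma poly_hull_le p (M : R) z : 0 <= M -> (forall y, K y -> cnorm (peval p y) <= M) ->
  poly_hull K z -> cnorm (peval p z) <= M.
Proof. by move=> M0 H /(_ p) /le_trans; apply; exact: unorm_le. Qed.

Lemma poly_hull_idem : poly_hull (poly_hull K) `<=` poly_hull K.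
Proof.
move=> z Hz p; apply: le_trans (Hz p) _.
by apply: unorm_le => [|y /(_ p)]; first exact: unorm_ge0.
Qed.

Lemma closed_poly_hull : closed (poly_hull K).
Proof.
have -> : poly_hull K = \bigcap_(p in [set: mpoly.mpoly n C])
    [set z | cnorm (peval p z) <= unorm K (peval p)].
  by apply/seteqP; split=> z Hz p; [move=> _; exact: Hz | exact: (Hz p I)].
by apply: closed_bigI => p _; exact/closed_norm_le/peval_continuous.
Qed.

(** The inequality defining the hull passes to uniform limits of polynomials. Hence the Shilov
    boundary of P of the hull lies in [K]. *)
Lemma poly_hull_boundary : compact (poly_hull K) ->
  closed_boundary (Palg (poly_hull K)) [set x | K (set_val x)].
Proof.
move=> cH; have H0 : poly_hull K !=set0.
  by have [z Kz] := K0; exists z; exact: sub_poly_hull.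
have uA := Palg_uniform_algebra H0 cH.
apply/(closed_boundaryP uA); split.
  have /continuous_closedP := @set_val_continuous _ (poly_hull K); apply.
  by apply: compact_closed cK; exact: norm_hausdorff.
move=> f Af; set E := [set x | _].
have fE x : E x -> cnorm (f x) <= unorm E f.
  by move=> Ex; apply: (le_unorm (M := unorm setT f)) => // y _; exact: (unorm_setT uA).
apply: unorm_le => [|x _]; first exact: unorm_ge0.
apply/ler_addgt0Pr => e e0; have e20 : 0 < e / 2 by lra.
have [p Hp] := Palg_approx Af e20.
have px : cnorm (polyres p x) <= unorm E f + e / 2.
  apply: poly_hull_le (set_valP x) => [|y Ky].
    by rewrite addr_ge0 ?unorm_ge0 // ltW.
  pose y' : set_type (poly_hull K) := exist _ y (mem_set (sub_poly_hull Ky)).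
  have -> : peval p y = f y' - (f y' - polyres p y') by rewrite opprB addrCA subrr addr0.
  by apply: cnormB_le; [exact: fE | exact/ltW/Hp].
have -> : f x = polyres p x + (f x - polyres p x) by rewrite addrCA subrr addr0.
have := cnormD_le px (ltW (Hp x)); lra.
Qed.

End Hull.

Theorem theorem1p1 (R : realType) :
  exists Y : set 'rV[R[i]]_2,
    [/\ Y !=set0, compact Y, Y `<=` top_boundary (closed_bidisk R),
        poly_hull Y 0 & dense_invertibles (Palg Y)] /\
    let X := poly_hull Y in let A := Palg X in
    [/\ compact X, uniform_algebra A, natural_on A, dense_invertibles A
      & exists G : set (set_type X),
          is_shilov_boundary A G /\ G `<` [set: set_type X]].
Proof.
have [f [f0 fd]] := dense_sequence R.
have [G [e [G0 GS Gdec]]] := refinement f0.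
pose Y := level_edge G; exists Y.
have cY : compact Y by exact: compact_level_edge.
have large := level_edge_large G0 Gdec.
have Y0 : Y !=set0 by have [z Yz _] := large 1 1 ltr01; exists z.
have YD : Y `<=` closed_bidisk R by move=> z [[]].
have hull0 : poly_hull Y 0.
  move=> p; apply/ler_addgt0Pr => d d0; have [z Yz] := large p d d0.
  by rewrite lerBlDr => /le_trans; apply; rewrite lerD2r cnorm_le_unorm.
(* Stated for [K] inside the hull, to serve for both Y and X. *)
have finv K : K !=set0 -> compact K -> K `<=` poly_hull Y ->
    forall n, invertibles (Palg K) (polyres (f n)).
  move=> K0 cK KY n.
  have [M M0 HM] := bidisk_bound (G n.+1).
  pose r : R := 1 + M ^+ 2; pose s := 1 - (2%:R * r ^+ 2)^-1.
  have r1 : 1 <= r by rewrite lerDl sqr_ge0.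
  have rr1 : 1 <= r ^+ 2 by rewrite exprn_ege1.
  have s1 : s < 1 by rewrite gtrBl invr_gt0; lra.
  have s0 : 0 <= s by rewrite subr_ge0 invf_le1; lra.
  pose q := 1 - (r%:C%C)^-1 *: G n.+1.
  have qE z : peval q z = 1 - peval (G n.+1) z / r%:C%C.
    by rewrite pevalB peval1 pevalZ mulrC.
  apply: (@Palg_invertible _ _ _ K0 cK (f n) q ((r%:C%C)^-1 *: e n) s s1).
    by move=> z Kz; rewrite qE subKr GS pevalM pevalZ mulrCA mulrC.
  move=> z /KY; apply: poly_hull_le => // y Yy; rewrite qE.
  by apply: cnorm_contract; [have [_] := Yy; apply | exact/HM/YD].
have XD : poly_hull Y `<=` closed_bidisk R.
  move=> z Xz i; rewrite -peval_var; apply: poly_hull_le Xz => // y /YD yD.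
  by rewrite peval_var; exact: yD.
have cX : compact (poly_hull Y).
  by apply: subclosed_compact (@compact_closed_bidisk R) XD; exact: closed_poly_hull.
have X0 : poly_hull Y !=set0 by exists 0.
have YX := sub_poly_hull Y0 cY.
split.
  split=> //; first by move=> z [/bidisk_edge_top_boundary].
  by apply: (Palg_dense_invertibles YD fd) => n; exact: finv.
have uA := Palg_uniform_algebra X0 cX.
split=> //.
- by apply: Palg_natural => //; exact: poly_hull_idem.
- by apply: (Palg_dense_invertibles XD fd) => n; exact: finv.
have shilov := shilov_boundary_exists uA.
eexists; split; first exact: shilov.
split=> // /(_ (exist _ 0 (mem_set hull0)) I).
(* The origin lies in X, but a point of Y has a coordinate of modulus 1. *)
move/(shilov.2 _ (poly_hull_boundary Y0 cY cX)) => -[[_ [j +]] _].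
by rewrite set_valE /= mxE cnorm0 => /eqP; rewrite eq_sym oner_eq0.
Qed.
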